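(* Given $N\in(2,\infty)$ and $K>0$, suppose that the compact measured length space $(X,d,\nu)$ has $N$-Ricci curvature bounded below by $K$. Then for any nonnegative Lipschitz function $f$ on $X$ with $\int_X f^{\frac{2N}{N-2}}\,d\nu=1$, one has $$1-\left(\int_X f\,d\nu\right)^{\frac{2}{N+2}}\ \le\ \frac{6}{KN}\left(\frac{N}{N-2}\right)^2\int_X|\nabla^-f|^2\,d\nu .$$
   Context: A compact measured length space $(X,d,\nu)$ is a compact length space $(X,d)$ with a Borel probability measure $\nu$. For a Lipschitz function $f$ on $X$, $|\nabla^-f|(x)=\limsup_{y\to x}\frac{[f(x)-f(y)]_+}{d(x,y)}$, $a_+=\max(a,0)$ (and $|\nabla^- f|(x)=0$ if $x$ is isolated). Transport notation: $\Gamma$ is the set of minimizing constant-speed geodesics $\gamma:[0,1]\to X$, $e_t(\gamma)=\gamma(t)$, $E=(e_0,e_1)$. A transference plan between $\mu_0,\mu_1\in P(X)$ is $\pi\in P(X\times X)$ with marginals $\mu_0,\mu_1$; it is optimal if it minimizes $\int d(x_0,x_1)^2\,d\pi$. An optimal dynamical transference plan from $\mu_0$ to $\mu_1$ is a Borel probability measure $\Pi$ on $\Gamma$ such that $\pi=E_*\Pi$ is an optimal transference plan between $\mu_0$ and $\mu_1$. Disintegrations: $d\pi(x_0,x_1)=d\pi(x_1|x_0)\,d\mu_0(x_0)=d\pi(x_0|x_1)\,d\mu_1(x_1)$. $\mathcal{DC}_N$ is the set of continuous convex $U:[0,\infty)\to\mathbb{R}$ with $U(0)=0$ such that $\lambda\mapsto\lambda^NU(\lambda^{-N})$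 is convex on $(0,\infty)$. $U'(\infty)=\lim_{r\to\infty}U(r)/r$, $U'(0)=\lim_{r\to0^+}U(r)/r$, and $U_\nu(\mu)=\int_XU(\rho)\,d\nu+U'(\infty)\mu_s(X)$ where $\mu=\rho\nu+\mu_s$ is the Lebesgue decomposition with respect to $\nu$ ($\infty\cdot0=0$). For $K>0$, $N\in(1,\infty)$ let $\alpha=\sqrt{\frac{K}{N-1}}\,d(x_0,x_1)$ and $\beta_t(x_0,x_1)=\left(\frac{\sin(t\alpha)}{t\sin\alpha}\right)^{N-1}$ if $\alpha\in[0,\pi]$ (with limiting values where the quotient is not defined), $\beta_t(x_0,x_1)=\infty$ if $\alpha>\pi$. $(X,d,\nu)$ has $N$-Ricci curvature bounded below by $K$ if for all $\mu_0,\mu_1\in P(X)$ with support in $\mathrm{supp}(\nu)$, with Lebesgue decompositions $\mu_0=\rho_0\nu+\mu_{0,s}$, $\mu_1=\rho_1\nu+\mu_{1,s}$, there is some optimal dynamical transference plan $\Pi$ from $\mu_0$ to $\mu_1$ such that, with $\mu_t=(e_t)_*\Pi$ and $\pi=E_*\Pi$, for all $U\in\mathcal{DC}_N$ and all $t\in[0,1]$, $$U_\nu(\mu_t)\le(1-t)\int_{X\times X}\beta_{1-t}(x_0,x_1)\,U\!\left(\tfrac{\rho_0(x_0)}{\beta_{1-t}(x_0,x_1)}\right)d\pi(x_1|x_0)\,d\nu(x_0)+t\int_{X\times X}\beta_t(x_0,x_1)\,U\!\left(\tfrac{\rho_1(x_1)}{\beta_t(x_0,x_1)}\right)d\pi(x_0|x_1)\,d\nu(x_1)+U'(\infty)\big((1-t)\mu_{0,s}[X]+t\mu_{1,s}[X]\big).$$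 If $\beta_t(x_0,x_1)=\infty$, $\beta_tU(\rho_1/\beta_t)$ is interpreted as $U'(0)\rho_1(x_1)$; similarly $\beta_{1-t}U(\rho_0/\beta_{1-t})$ is interpreted as $U'(0)\rho_0(x_0)$ if $\beta_{1-t}=\infty$. *)

(* Defs.v *)
From HB Require Import structures.
From mathcomp Require Import all_boot all_order all_algebra.
From mathcomp Require Import all_classical all_reals all_analysis.
Set Implicit Arguments.
Unset Strict Implicit.
Unset Printing Implicit Defensive.
Import Order.TTheory GRing.Theory Num.Theory.
Import numFieldNormedType.Exports.
Local Open Scope classical_set_scope.
Local Open Scope ring_scope.

(* The library's measurable types are pointed.  Pointedness is no restriction
   here: a space that carries a probability measure is nonempty. *)
#[short(type="pmetricType")]
HB.structure Definition PointedMetric (R : numDomainType) :=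
  {M of Metric R M & Pointed M}.

Notation borel T := (@g_sigma_algebraType T (@open T)).

Section length_spaces.
Context {R : realType} (X : metricType R).

Definition path_length (c : R -> X) : \bar R :=
  ereal_sup [set (\sum_(0 <= i < size s)
                   mdist (c (nth 1 (0 :: s) i)) (c (nth 1 (0 :: s) i.+1)))%:E
            | s in itv_partition 0 1].

Definition length_space : Prop := forall x y : X,
  (mdist x y)%:E =
  ereal_inf [set path_length c | c in
    [set c : R -> X |
      [/\ {within `[0, 1], continuous c}, c 0 = x & c 1 = y]]].

End length_spaces.

Section descending_slope.
Context {R : realType} (X : metricType R).

Definition lipschitz_fun (f : X -> R) : Prop :=
  exists L : R, forall x y, `|f x - f y| <= L * mdist x y.

(* The case split matters: at an isolated point x^' contains the empty set, so
   that [limf_esup] would be -oo. *)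
Definition descending_slope (f : X -> R) (x : X) : \bar R :=
  if `[< isolated [set: X] x >] then 0%E
  else limf_esup (fun y => (Num.max (f x - f y) 0 / mdist x y)%:E) x^'.

End descending_slope.

Section geodesics.
Context {R : realType} (X : pmetricType R).

Definition is_geodesic (g : arrow_uniform_type {i01 R} X) : Prop :=
  forall s t : {i01 R},
    mdist (g s) (g t) = `|s%:num - t%:num| * mdist (g 0%:i01) (g 1%:i01).

(* The space of geodesics, with the topology of uniform convergence. *)
Definition geodesic := set_type [set g | is_geodesic g].

HB.instance Definition _ := PseudoMetric.on geodesic.

Definition constant_path (x : X) : arrow_uniform_type {i01 R} X := fun=> x.

Lemma constant_path_geodesic x : is_geodesic (constant_path x).
Proof. by move=> s t; rewrite /constant_path mdistxx mulr0. Qed.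

HB.instance Definition _ := isPointed.Build geodesic
  (SigSub (mem_set (constant_path_geodesic point))).

Definition geodesic_eval (t : {i01 R}) (g : borel geodesic) : borel X :=
  (\val g : arrow_uniform_type {i01 R} X) t.

Lemma geodesic_eval_continuous (t : {i01 R}) :
  continuous (geodesic_eval t : geodesic -> X).
Proof.
move=> g A; rewrite -!nbhs_ballE => -[e e0 eA].
exists e => // h gh.
by apply: eA; exact: gh.
Qed.

Lemma geodesic_eval_measurable (t : {i01 R}) :
  measurable_fun setT (geodesic_eval t).
Proof.
apply: (@measurability _ _ _ (borel X) setT _ (@open X)) => // _ [B oB <-]; rewrite setTI.
apply: sub_sigma_algebra.
by apply: (@open_comp geodesic X) oB => g _; exact: geodesic_eval_continuous.
Qed.

HB.instance Definition _ (t : {i01 R}) :=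
  isMeasurableFun.Build _ _ _ _ (geodesic_eval t) (geodesic_eval_measurable t).

Definition geodesic_ends (g : borel geodesic) : (borel X * borel X)%type :=
  (geodesic_eval 0%:i01 g, geodesic_eval 1%:i01 g).

Lemma geodesic_ends_measurable : measurable_fun setT geodesic_ends.
Proof. by apply: measurable_fun_pair; exact: geodesic_eval_measurable. Qed.

HB.instance Definition _ :=
  isMeasurableFun.Build _ _ _ _ geodesic_ends geodesic_ends_measurable.

End geodesics.

Section transport.
Context {R : realType} (X : pmetricType R).
Local Open Scope ereal_scope.
Implicit Types mu : probability (borel X) R.
Implicit Types ppi : probability (borel X * borel X)%type R.

Definition measure_support mu : set X :=
  [set x | forall V : set X, open V -> V x -> 0 < mu V].

Definition transference_plan mu0 mu1 ppi : Prop :=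
  forall A : set (borel X), measurable A ->
    ppi (A `*` setT) = mu0 A /\ ppi (setT `*` A) = mu1 A.

Definition transport_cost ppi : \bar R :=
  \int[ppi]_p ((mdist (p.1 : X) (p.2 : X)) ^+ 2)%:E.

Definition optimal_plan mu0 mu1 ppi : Prop :=
  transference_plan mu0 mu1 ppi /\
  forall ppi', transference_plan mu0 mu1 ppi' ->
    transport_cost ppi <= transport_cost ppi'.

Definition optimal_dynamical_plan mu0 mu1
    (Pi : probability (borel (geodesic X)) R) : Prop :=
  optimal_plan mu0 mu1 (distribution Pi (@geodesic_ends R X)).

(* [k0 x0] is pi(dx1 | x0) and [k1 x1] is pi(dx0 | x1). *)
Definition disintegration_fst mu0 ppi
    (k0 : R.-pker (borel X) ~> (borel X)) : Prop :=
  forall A B : set (borel X), measurable A -> measurable B ->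
    ppi (A `*` B) = \int[mu0]_(x0 in A) k0 x0 B.

Definition disintegration_snd mu1 ppi
    (k1 : R.-pker (borel X) ~> (borel X)) : Prop :=
  forall A B : set (borel X), measurable A -> measurable B ->
    ppi (A `*` B) = \int[mu1]_(x1 in B) k1 x1 A.

Definition lebesgue_decomposition (nu mu : probability (borel X) R)
    (rho : borel X -> R) (mus : {measure set (borel X) -> \bar R}) : Prop :=
  [/\ measurable_fun setT rho,
      forall x, (0 <= rho x)%R,
      exists S : set (borel X), [/\ measurable S, nu S = 0 & mus (~` S) = 0] &
      forall A : set (borel X), measurable A ->
        mu A = \int[nu]_(x in A) (rho x)%:E + mus A].

End transport.

Section displacement_convexity_class.
Context {R : realType}.

Record DC (N : R) (U : R -> R) : Prop := {
  DC_continuous : {within `[0, +oo[, continuous U};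
  DC_convex : convex_function (`[0, +oo[ : set R^o) U;
  DC_at0 : U 0 = 0;
  DC_dim_convex :
    convex_function (`]0, +oo[ : set R^o) (fun l => l `^ N * U (l `^ (- N)))
}.

Definition slope_at_infty (U : R -> R) : \bar R :=
  lim ((U r / r)%:E @[r --> +oo]).

Definition slope_at_zero (U : R -> R) : \bar R :=
  lim ((U r / r)%:E @[r --> 0^'+]).

(* U_nu(mu), in terms of the Lebesgue decomposition mu = rho nu + mus. *)
Definition U_functional (X : pmetricType R) (nu : probability (borel X) R)
    (U : R -> R) (rho : borel X -> R)
    (mus : {measure set (borel X) -> \bar R}) : \bar R :=
  (\int[nu]_x (U (rho x))%:E + slope_at_infty U * mus setT)%E.

(* The quotient sin (t a) / (t sin a) is undefined for t = 0, a = 0 or a = pi;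
   the limiting values are obtained by letting a -> pi with a < pi, a -> 0 and
   t -> 0.  For t = 1 the quotient is 1 for all a in ]0, pi[, whence the value
   1 also for a = 0 and a = pi. *)
Definition beta (K N t d : R) : \bar R :=
  let a := Num.sqrt (K / (N - 1)) * d in
  if pi < a then +oo%E
  else if t == 1 then 1%E
  else if a == pi then +oo%E
  else if a == 0 then 1%E
  else if t == 0 then ((a / sin a) `^ (N - 1))%:E
  else ((sin (t * a) / (t * sin a)) `^ (N - 1))%:E.

(* beta U(r / beta), read as U'(0) r for infinite beta. *)
Definition perspective (U : R -> R) (b : \bar R) (r : R) : \bar R :=
  if b is b'%:E then (b' * U (r / b'))%:E else (slope_at_zero U * r%:E)%E.

End displacement_convexity_class.

Section ricci.
Context {R : realType} (X : pmetricType R).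
Local Open Scope ereal_scope.

Definition distorted_bound (nu : probability (borel X) R) (K N : R)
    (U : R -> R) (t : R) (rho0 rho1 : borel X -> R)
    (mus0 mus1 : {measure set (borel X) -> \bar R})
    (k0 k1 : R.-pker (borel X) ~> (borel X)) : \bar R :=
  (1 - t)%:E *
    (\int[nu]_x0 \int[k0 x0]_x1
       perspective U (beta K N (1 - t) (mdist (x0 : X) (x1 : X))) (rho0 x0)) +
  t%:E *
    (\int[nu]_x1 \int[k1 x1]_x0
       perspective U (beta K N t (mdist (x0 : X) (x1 : X))) (rho1 x1)) +
  slope_at_infty U * ((1 - t)%:E * mus0 setT + t%:E * mus1 setT).

(* Disintegrations and Lebesgue decompositions exist and are essentially
   unique, so it is immaterial whether they are quantified existentially or
   universally.  No indeterminate +oo - oo arises in [distorted_bound]: the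
   inequality for U(r) = - r `^ (1 - 1 / N) already forces the negative parts
   of the integrands to be integrable, for every U in DC_N. *)
Definition ricci_bounded_below (nu : probability (borel X) R) (N K : R) :
    Prop :=
  forall (mu0 mu1 : probability (borel X) R) (rho0 rho1 : borel X -> R)
    (mus0 mus1 : {measure set (borel X) -> \bar R}),
    measure_support mu0 `<=` measure_support nu ->
    measure_support mu1 `<=` measure_support nu ->
    lebesgue_decomposition nu mu0 rho0 mus0 ->
    lebesgue_decomposition nu mu1 rho1 mus1 ->
  exists Pi : probability (borel (geodesic X)) R,
    optimal_dynamical_plan mu0 mu1 Pi /\
  exists k0 k1 : R.-pker (borel X) ~> (borel X),
    [/\ disintegration_fst mu0 (distribution Pi (@geodesic_ends R X)) k0,
        disintegration_snd mu1 (distribution Pi (@geodesic_ends R X)) k1 &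
        forall t : {i01 R},
        exists (rhot : borel X -> R)
               (must : {measure set (borel X) -> \bar R}),
          lebesgue_decomposition nu (distribution Pi (geodesic_eval t))
            rhot must /\
          forall U : R -> R, DC N U ->
            U_functional nu U rhot must <=
            distorted_bound nu K N U t%:num rho0 rho1 mus0 mus1 k0 k1].

End ricci.

(* Main.v *)
Require Import Defs.
From HB Require Import structures.
From mathcomp Require Import all_boot all_order all_algebra.
From mathcomp Require Import all_classical all_reals all_analysis.
From mathcomp Require Import measurable_realfun ring lra.
Set Implicit Arguments.
Unset Strict Implicit.
Unset Printing Implicit Defensive.
Import Order.TTheory GRing.Theory Num.Theory.
Import numFieldNormedType.Exports.
Local Open Scope classical_set_scope.
Local Open Scope ring_scope.

(** Let [q = 2 N / (N - 2)], [p = 1 - 1 / N] and suppose first that [f] is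
bounded below by a positive constant.  Then [rho = f ^ q] is the density of a
probability measure [mu0], and the curvature hypothesis provides a plan [Pi]
that moves [mu0] to the reference measure [nu].  Apply the hypothesis to
[U r = - r ^ p], the extremal element of the class DC_N, and to a small time
[t]; write [rho_t] for the density of the measure at time [t], [D] for the
length of a geodesic and [kappa = K / (6 N)].

On the right-hand side, the distortion coefficient enters only through
[beta ^ (1 / N)], and
[beta_t ^ (1 / N) >= 1 + kappa (1 - t ^ 2) D ^ 2] because
[sin x * exp (x ^ 2 / 6) / x] decreases on [0, pi] ([expR_le_sin_quotient],
[perspective_beta_le]).  On the left-hand side, the tangent line of the concave
function [r ^ p] at [rho] bounds the integral of [rho_t ^ p] by that of
[psi = rho ^ (p - 1)] over the geodesics at time [t].  Together
([concavity_along_plan]), with [A] the integral of [rho ^ p],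
[[
  t (1 + kappa (1 - t ^ 2) int D ^ 2 dPi - A)
    <= p int (psi (gamma_t) - psi (gamma_0)) dPi.
]]
Divide by [t] and let [t] tend to [0].  As [psi = f ^ (- a)] with
[a = 2 / (N - 2)] is a convex decreasing function of [f], its difference
quotients along a geodesic are asymptotically at most [w s D], where
[w = a f ^ (- a - 1)] and [s] is the descending slope of [f]
([first_variation], a reverse Fatou lemma).  Hence
[1 + kappa int D ^ 2 dPi - A <= p int w s D dPi].  Young's inequality with the
weight [kappa] makes the integral of [D ^ 2] cancel ([young_along_plan]), and
what is left is the integral of [w ^ 2 s ^ 2] against [mu0], that is
[a ^ 2] times the integral of [s ^ 2] against [nu], since
[w ^ 2 = a ^ 2 / rho].  This is [sobolev_positive]:
[[
  1 <= A + 6 / (K N) ((N - 1) / (N - 2)) ^ 2 int s ^ 2 dnu.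
]]
Finally [A], the integral of [f ^ (q p)], is at most the power [2 / (N + 2)] of
the integral of [f] by Hoelder's inequality ([Rintegral_interpolation]).

For a general [f] the argument is applied to [(f + e) / z] with [e > 0] and [z]
the Lebesgue norm of [f + e] with exponent [q].  As [z >= 1], the slope of this
function is at most that of [f] and its mean at most that of [f + e]; then [e]
tends to [0]. *)

(** * The distortion quotient *)

Section trig.
Context {R : realType}.
Implicit Types x y t a : R.

Lemma decreasing_from_derivative (f f' : R -> R) (a b : R) :
  (forall x, a <= x <= b -> is_derive x 1 f (f' x)) ->
  (forall x, a <= x <= b -> f' x <= 0) -> a <= b -> f b <= f a.
Proof.
move=> df f'0 ab; apply: (@ler0_derive1_le_cc R f a b) => //.
- move=> x /[!in_itv]/= /andP[ax xb].
  by have /df dx : a <= x <= b by rewrite !ltW.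
- move=> x /[!in_itv]/= /andP[ax xb].
  have axb : a <= x <= b by rewrite !ltW.
  by rewrite derive1E (@derive_val _ _ _ _ _ _ _ (df x axb)) f'0.
- apply: derivable_within_continuous => x /[!in_itv]/= axb.
  by have := df x axb.
- by rewrite in_itv/= ab lexx.
- by rewrite in_itv/= ab lexx.
Qed.

Lemma mul_cos_le_sin x : 0 <= x <= pi -> x * cos x <= sin x.
Proof.
move=> /andP[x0 xpi]; rewrite -subr_le0.
have -> : 0 = 0 * cos 0 - sin 0 :> R by rewrite sin0 mul0r subr0.
apply: (@decreasing_from_derivative (fun x => x * cos x - sin x)
  (fun x => - (x * sin x)) 0 x) => //.
- move=> y _; apply: is_derive_eq.
  rewrite /GRing.scale/=; ring.
- move=> y /andP[y0 yx]; rewrite oppr_le0 mulr_ge0// sin_ge0_pi// y0/=.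
  exact: le_trans xpi.
Qed.

(** Up to the factor [exp (x ^ 2 / 6) / x ^ 2], the left-hand side is the
derivative of [sin x * exp (x ^ 2 / 6) / x]. It vanishes at [0], and its own
derivative is [x / 3 * (x cos x - sin x)]. *)
Lemma sin_quotient_derivative_le0 x : 0 <= x <= pi ->
  x * cos x - sin x + x ^+ 2 / 3 * sin x <= 0.
Proof.
move=> /andP[x0 xpi].
have -> : 0 = 0 * cos 0 - sin 0 + 0 ^+ 2 / 3 * sin 0 :> R.
  by rewrite sin0; ring.
apply: (@decreasing_from_derivative
  (fun x => x * cos x - sin x + x ^+ 2 / 3 * sin x)
  (fun x => x / 3 * (x * cos x - sin x)) 0 x) => //.
- move=> y _; apply: is_derive_eq.
  by rewrite /GRing.scale/=; field.
- move=> y /andP[y0 yx]; apply: mulr_ge0_le0; first exact: divr_ge0.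
  by rewrite subr_le0 mul_cos_le_sin// y0 (le_trans yx).
Qed.

(** This compares the values at [t a] and at [a] of the decreasing function
[sin x * exp (x ^ 2 / 6) / x]. The exponential is essential: the quotient will
be raised to the power [(N - 1) / N], and as this exponent is less than [1] a
bound of the form [1 + c] would not give [1 + (N - 1) / N * c]. *)
Lemma expR_le_sin_quotient t a : 0 < t < 1 -> 0 < a < pi ->
  expR ((1 - t ^+ 2) * a ^+ 2 / 6) <= sin (t * a) / (t * sin a).
Proof.
move=> /andP[t0 t1] /andP[a0 api].
have ta0 : 0 < t * a by rewrite mulr_gt0.
have taa : t * a <= a by rewrite ler_piMl// ltW.
have sa : 0 < sin a by rewrite sin_gt0_pi// a0.
pose q x : R := sin x * expR (x ^+ 2 / 6) * x^-1.
have : q a <= q (t * a).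
  apply: (@decreasing_from_derivative q (fun x => expR (x ^+ 2 / 6) / x ^+ 2 *
    (x * cos x - sin x + x ^+ 2 / 3 * sin x)) (t * a) a) => //.
  - move=> y /andP[y1 y2]; rewrite /q.
    have y0 : y != 0 by rewrite gt_eqF// (lt_le_trans ta0).
    have dinv : is_derive y (1 : R) (fun x : R => x^-1) (- y ^- 2).
      apply: DeriveDef; first exact: (@derivableV _ _ id).
      by rewrite (@deriveV _ _ id)// derive_id /GRing.scale/= mulr1.
    by apply: is_derive_eq; rewrite /GRing.scale/=; field.
  - move=> y /andP[y1 y2]; have y0 := lt_le_trans ta0 y1.
    apply: mulr_ge0_le0; first by rewrite divr_ge0 ?expR_ge0 ?sqr_ge0.
    by rewrite sin_quotient_derivative_le0// (ltW y0) (le_trans y2)// ltW.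
rewrite /q => H.
rewrite (_ : (1 - t ^+ 2) * a ^+ 2 / 6 = a ^+ 2 / 6 - (t * a) ^+ 2 / 6);
  last by ring.
rewrite expRD expRN ler_pdivlMr ?mulr_gt0// mulrAC ler_pdivrMr ?expR_gt0//.
move: H; rewrite ler_pdivrMr//
  (_ : _ / _ * a = sin (t * a) * expR ((t * a) ^+ 2 / 6) / t); last first.
  by field; rewrite !gt_eqF.
rewrite ler_pdivlMr//; apply: le_trans.
by rewrite [leRHS]mulrC (mulrC (sin a)) mulrCA.
Qed.
End trig.

(** * Powers and the functional with integrand - r ^ p *)

Section powers.
Context {R : realType}.
Implicit Types p x y N a u v : R.

Lemma powR_weighted_AMGM p x y : 0 < p < 1 -> 0 <= x -> 0 <= y ->
  x `^ p * y `^ (1 - p) <= p * x + (1 - p) * y.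
Proof.
move=> /andP[p0 p1] x0 y0; have q0 : 0 < 1 - p by rewrite subr_gt0.
have := @conjugate_powR R (x `^ p) (y `^ (1 - p)) p^-1 (1 - p)^-1
  (powR_ge0 _ _) (powR_ge0 _ _).
rewrite !invr_gt0 !invrK => /(_ p0 q0); rewrite addrC subrK => /(_ erefl).
by rewrite -!powRrM !divff ?gt_eqF// !powRr1//
  ![_ * p]mulrC ![_ * (1 - p)]mulrC.
Qed.

(** The graph of a concave power lies below its tangent at [y]. *)
Lemma powR_tangent p x y : 0 < p < 1 -> 0 <= x -> 0 < y ->
  x `^ p <= p * x * y `^ (p - 1) + (1 - p) * y `^ p.
Proof.
move=> p01 x0 y0; have /(ler_wpM2r (powR_ge0 y (p - 1))) :=
  powR_weighted_AMGM p01 x0 (ltW y0).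
rewrite -[leLHS]mulrA -powRD; last by apply/implyP => _; rewrite gt_eqF.
rewrite (_ : 1 - p + (p - 1) = 0); last by ring.
rewrite powRr0 mulr1 => /le_trans; apply.
by rewrite mulrDl lerD2l -mulrA mulr_powRB1 ?(ltW y0)//; case/andP: p01.
Qed.

(** A negative power is convex; after scaling by [u], this is
[z ^ (- a) = exp (- a ln z) >= 1 - a ln z >= 1 - a (z - 1)]. *)
Lemma powR_convex_tangent a u v : 0 <= a -> 0 < u -> 0 < v ->
  u `^ (- a) - v `^ (- a) <= a * u `^ (- a - 1) * (v - u).
Proof.
move=> a0 u0 v0.
have lnle (z : R) : 0 < z -> ln z <= z - 1.
  by move=> z0; have := expR_ge1Dx (ln z); rewrite lnK//; lra.
have z0 : 0 < v / u by rewrite divr_gt0.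
have H : 1 - a * (v / u - 1) <= (v / u) `^ (- a).
  apply: (@le_trans _ _ (1 + (- a) * ln (v / u))).
    by rewrite mulNr lerD2l lerN2 ler_wpM2l// lnle.
  by rewrite /powR gt_eqF// expR_ge1Dx.
have vE : v `^ (- a) = u `^ (- a) * (v / u) `^ (- a).
  by rewrite -powRM ?(ltW u0) ?(ltW z0)// mulrC divfK// gt_eqF.
have uE : u `^ (- a - 1) = u `^ (- a) / u.
  rewrite powRB; last by apply/implyP => _; rewrite gt_eqF.
  by rewrite powRr1// ltW.
rewrite vE uE; have := ler_wpM2l (powR_ge0 u (- a)) H.
rewrite (_ : a * _ * _ = u `^ (- a) * (a * (v / u - 1))); last first.
  by field; rewrite gt_eqF.
by lra.
Qed.

Lemma powR_continuous_at (r y : R) : 0 < y -> {for y,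
  continuous (@powR R ^~ r)}.
Proof.
move=> y0; have : derivable (powR (R:=R) ^~ r) y 1.
  by apply: derivable_powR; rewrite in_itv/= y0.
by move/derivable1_diffP/differentiable_continuous.
Qed.

Lemma powR_concave p t x y : 0 < p < 1 -> 0 <= t <= 1 -> 0 <= x -> 0 <= y ->
  t * x `^ p + (1 - t) * y `^ p <= (t * x + (1 - t) * y) `^ p.
Proof.
move=> p01 /andP[t0 t1] x0 y0; have s0 : 0 <= 1 - t by rewrite subr_ge0.
have p0 : 0 < p by case/andP: p01.
set z := t * x + _.
have z0 : 0 <= z by rewrite addr_ge0// mulr_ge0.
have [z_eq0|zn0] := eqVneq z 0.
  have /andP[tx sy] : (t * x == 0) && ((1 - t) * y == 0).
    by rewrite -paddr_eq0 ?mulr_ge0//; apply/eqP.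
  have mul_powR0 a b : a * b == 0 -> a * b `^ p = 0.
    by rewrite mulf_eq0 => /orP[]/eqP ->; rewrite ?mul0r// powR0 ?mulr0//
      gt_eqF.
  by rewrite !mul_powR0// addr0 powR_ge0.
have {}z0 : 0 < z by rewrite lt_neqAle eq_sym zn0.
apply: le_trans (lerD (ler_wpM2l t0 (powR_tangent p01 x0 z0))
                      (ler_wpM2l s0 (powR_tangent p01 y0 z0))) _.
rewrite [leLHS](_ : _ = p * (z * z `^ (p - 1)) + (1 - p) * z `^ p).
  by rewrite mulr_powRB1 ?(ltW z0)//; lra.
by move: (z `^ (p - 1)) (z `^ p) => u v; rewrite /z; ring.
Qed.

(** The last condition in the class holds with equality:
[l ^ N * U (l ^ (- N)) = - l]. *)
Lemma DC_opp_powR N : 1 < N -> DC N (fun r => - r `^ (1 - N^-1)).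
Proof.
move=> N1; have N0 : 0 < N by lra.
have p01 : 0 < 1 - N^-1 < 1.
  by rewrite subr_gt0 invf_lt1// N1 gtrBl invr_gt0.
have p0 : 0 < 1 - N^-1 by case/andP: p01.
split.
- apply/continuous_within_itvcyP; split.
    move=> x /[!in_itv]/= /[!andbT] x0; apply: cvgN.
    have : derivable (powR (R:=R) ^~ (1 - N^-1)) x 1.
      by apply: derivable_powR; rewrite in_itv/= x0.
    by move/derivable1_diffP/differentiable_continuous.
  by apply: cvgN; rewrite powR0 ?gt_eqF//; exact: powR_cvg0.
- move=> t x y /[!inE]/= /[!in_itv]/= /[!andbT] x0 y0.
  have t01 : 0 <= t%:num <= 1 by rewrite ge0 le1.
  have := powR_concave p01 t01 x0 y0.
  by rewrite -lerN2 opprD -!mulrN.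
- by rewrite powR0 ?oppr0// gt_eqF.
- move=> t x y /[!inE]/= /[!in_itv]/= /[!andbT] x0 y0.
  have H z : 0 < z -> z `^ N * - (z `^ (- N)) `^ (1 - N^-1) = - z.
    move=> z0; rewrite mulrN -powRrM -powRD; last by apply/implyP => _;
      rewrite gt_eqF.
    rewrite (_ : N + - N * _ = 1); first by rewrite powRr1// ltW.
    by rewrite mulrBr mulr1 mulNr divff ?gt_eqF//; ring.
  rewrite !H//; last exact: convR_gt0.
  by rewrite !convRE !mulrN opprD.
Qed.


Lemma opp_powR_quotient p r : 0 < r -> - r `^ p / r = - r `^ (p - 1).
Proof.
move=> r0; rewrite mulNr -[X in _ / X]powRr1 ?(ltW r0)// -powRN -powRD//.
by apply/implyP => _; rewrite gt_eqF.
Qed.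

Lemma slope_at_infty_opp_powR p : 0 < p < 1 ->
  slope_at_infty (fun r => - r `^ p) = 0%E.
Proof.
move=> /andP[p0 p1]; apply/cvg_lim => //; apply: cvg_EFin; first by near=> x.
have q0 : 0 < 1 - p by rewrite subr_gt0.
apply/cvgrPdist_le => e e0; near=> r.
have r0 : 0 < r by near: r; exact: nbhs_pinfty_gt.
have re : e^-1 `^ (1 - p)^-1 <= r by near: r; exact: nbhs_pinfty_ge.
rewrite /= opp_powR_quotient// sub0r opprK ger0_norm ?powR_ge0//.
(* r ^ (p - 1) <= e as soon as r >= e ^ (1 / (p - 1)). *)
rewrite -opprB powRN invf_ple ?posrE ?powR_gt0//.
have -> : e^-1 = (e^-1 `^ (1 - p)^-1) `^ (1 - p).
  by rewrite -powRrM mulVf ?gt_eqF// powRr1// invr_ge0 ltW.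
by rewrite ge0_ler_powR ?nnegrE ?powR_ge0 ?(ltW r0) ?(ltW q0).
Unshelve. all: by end_near. Qed.

(** Because of this value, an infinite distortion coefficient makes the upper
bound for the functional equal to [-oo], so that pairs of points at distance at
least [pi / sqrt (K / (N - 1))] need no separate treatment. *)
Lemma slope_at_zero_opp_powR p : 0 < p < 1 ->
  slope_at_zero (fun r => - r `^ p) = -oo%E.
Proof.
move=> /andP[p0 p1]; apply/cvg_lim => //; apply/cvgerNyP.
have q0 : 0 < 1 - p by rewrite subr_gt0.
apply/cvgrNyPleNy; near=> M; near=> r.
have r0 : 0 < r by near: r; exact: nbhs_right_gt.
have M0 : M < 0 by near: M; exact: nbhs_ninfty_lt.
have rM : r <= (- M)^-1 `^ (1 - p)^-1.
  near: r; apply: nbhs_right_le; rewrite powR_gt0// invr_gt0 oppr_gt0//.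
rewrite opp_powR_quotient// lerNl.
rewrite -[p - 1]opprB powRN -[leLHS]invrK lef_pV2 ?posrE ?powR_gt0 ?invr_gt0
  ?oppr_gt0//.
have -> : (- M)^-1 = ((- M)^-1 `^ (1 - p)^-1) `^ (1 - p).
  by rewrite -powRrM mulVf ?gt_eqF// powRr1// invr_ge0 oppr_ge0 ltW.
by rewrite ge0_ler_powR ?nnegrE ?powR_ge0 ?(ltW r0) ?(ltW q0).
Unshelve. all: by end_near. Qed.

End powers.

Section distortion.
Context {R : realType}.
Implicit Types K N t d r b : R.

Lemma perspective_opp_powR p b r : 0 < b -> 0 <= r ->
  perspective (fun s => - s `^ p) b%:E r = (- (b `^ (1 - p) * r `^ p))%:E.
Proof.
move=> b0 r0; rewrite /perspective powRM ?invr_ge0 ?(ltW b0)//.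
rewrite powRB; last by apply/implyP => _; rewrite gt_eqF.
rewrite powRr1 ?(ltW b0)// -[in LHS]powR_inv1 ?(ltW b0)// -powRrM mulN1r powRN.
by congr (_%:E); ring.
Qed.

(** For finite [beta] the left-hand side is
[- beta ^ (1 / N) * r ^ (1 - 1 / N)], and
[beta ^ (1 / N) >= exp ((N - 1) / N * (1 - t ^ 2) * alpha ^ 2 / 6)] with
[alpha ^ 2 = K / (N - 1) * d ^ 2]. *)
Lemma perspective_beta_le K N t d r :
  2 < N -> 0 < K -> 0 < t < 1 -> 0 <= d -> 0 < r ->
  (perspective (fun s : R => (- s `^ (1 - N^-1))%R) (beta K N t d) r <=
   (- ((1 + K / (6 * N) * (1 - t ^+ 2) * d ^+ 2) * r `^ (1 - N^-1)))%:E)%E.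
Proof.
move=> N2 K0 /andP[t0 t1] d0 r0.
have N0 : 0 < N by lra.
have N1 : 1 < N by lra.
have p01 : 0 < 1 - N^-1 < 1.
  by rewrite subr_gt0 invf_lt1// N1 gtrBl invr_gt0.
have infinite_case : (perspective (fun s : R => (- s `^ (1 - N^-1))%R) +oo r <=
    (- ((1 + K / (6 * N) * (1 - t ^+ 2) * d ^+ 2) * r `^ (1 - N^-1)))%:E)%E.
  by rewrite /perspective slope_at_zero_opp_powR// gt0_mulNye ?lte_fin// leNye.
have KN0 : 0 < K / (N - 1) by rewrite divr_gt0// subr_gt0.
rewrite /beta; set a := Num.sqrt _ * d.
have a0 : 0 <= a by rewrite mulr_ge0// sqrtr_ge0.
case: ifPn => // api; rewrite (lt_eqF t1); case: ifPn => // apin.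
case: ifPn => [|a0n].
  rewrite mulf_eq0 sqrtr_eq0 leNgt KN0/= => /eqP ->.
  rewrite [leLHS](perspective_opp_powR _ ltr01 (ltW r0)) powR1.
  by rewrite expr0n/= mulr0 addr0.
rewrite (gt_eqF t0).
have {}a0 : 0 < a by rewrite lt_neqAle eq_sym a0n.
have {}api : a < pi by rewrite lt_neqAle apin leNgt.
have q1 : expR ((1 - t ^+ 2) * a ^+ 2 / 6) <= sin (t * a) / (t * sin a).
  by rewrite expR_le_sin_quotient ?t0 ?a0.
set q := sin (t * a) / _ in q1 *.
have q0 : 0 < q := lt_le_trans (expR_gt0 _) q1.
rewrite perspective_opp_powR ?powR_gt0 ?(ltW r0)// lee_fin lerN2.
rewrite ler_wpM2r ?powR_ge0// subKr -powRrM.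
have m0 : 0 <= (N - 1) / N by rewrite divr_ge0 ?subr_ge0 ?(ltW N1) ?(ltW N0).
apply: (@le_trans _ _ (expR ((1 - t ^+ 2) * a ^+ 2 / 6) `^ ((N - 1) / N)));
  last first.
  by rewrite ge0_ler_powR// nnegrE ?expR_ge0// ltW.
rewrite -expRM; apply: le_trans (expR_ge1Dx _).
rewrite lerD2l exprMn sqr_sqrtr ?(ltW KN0)// le_eqVlt; apply/orP; left;
  apply/eqP.
by field; rewrite !gt_eqF// subr_gt0.
Qed.
End distortion.

(** * Integrals of unmeasured functions, and mixtures of measures *)

Section integral_monotonicity.
Context d (T : measurableType d) (R : realType).
Variable mu : {measure set T -> \bar R}.
Implicit Types f g : T -> \bar R.
Local Open Scope ereal_scope.

(** The integral of a nonnegative function is the supremum of those of the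
simple functions below it, so measurability is irrelevant. This serves for the
iterated integrals of the distortion coefficients. *)
Lemma ge0_le_integral_any f g : (forall x, 0 <= f x) ->
  (forall x, f x <= g x) -> \int[mu]_x f x <= \int[mu]_x g x.
Proof.
move=> f0 fg; have g0 x : 0 <= g x by exact: le_trans (f0 x) (fg x).
rewrite !ge0_integralTE//; apply: le_ereal_sup => _ [h hf <-].
by exists h => // x; exact: le_trans (hf x) (fg x).
Qed.

Lemma integral_le_opp f g : (forall x, 0 <= g x) ->
  (forall x, f x <= - g x) -> \int[mu]_x f x <= - \int[mu]_x g x.
Proof.
move=> g0 fg; have gf x : g x <= - f x by rewrite leeNr.
have -> : \int[mu]_x f x = - \int[mu]_x - f x.
  rewrite -integral_ge0N; last by move=> x _; exact: le_trans (g0 x) (gf x).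
  by apply: eq_integral => x _; rewrite oppeK.
by rewrite leeN2; exact: ge0_le_integral_any.
Qed.

End integral_monotonicity.

Section mixture.
Context d d' (Y : measurableType d) (Z : measurableType d') (R : realType).
Variables (mu : {measure set Y -> \bar R}) (k : Y -> {measure set Z -> \bar R}).
Hypothesis mk : forall U : set Z, measurable U ->
  measurable_fun [set: Y] (fun y => k y U : \bar R).
Local Open Scope ereal_scope.

(** A measure with a density is a mixture of multiples of Dirac measures, and a
measure on a product is the mixture of its conditional measures; the formula
[integral_mixture] covers both. *)
Definition mixture of (forall U : set Z, measurable U ->
  measurable_fun [set: Y] (fun y => k y U : \bar R)) :=
  fun U : set Z => \int[mu]_y k y U.

Local Notation mix := (mixture mk).

Let mix0 : mix set0 = 0.
Proof. by apply: integral0_eq => y _; rewrite measure0. Qed.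

Let mix_ge0 U : 0 <= mix U. Proof. exact: integral_ge0. Qed.

Let mix_sigma_additive : semi_sigma_additive mix.
Proof.
move=> U mU tU mUU; rewrite [X in _ --> X](_ : _ =
  \int[mu]_y (\sum_(n <oo) k y (U n))); last first.
  apply: eq_integral => y _.
  by apply/esym/cvg_lim => //; exact/measure_semi_sigma_additive.
apply/cvg_closeP; split.
  by apply: is_cvg_nneseries => n _ _; exact: integral_ge0.
by rewrite closeE// integral_nneseries// => n; exact: mk.
Qed.

HB.instance Definition _ := isMeasure.Build _ _ R mix
  mix0 mix_ge0 mix_sigma_additive.

Import HBNNSimple.

Let integral_mixture_nnsfun (h : {nnsfun Z >-> R}) :
  \int[mix]_z (h z)%:E = \int[mu]_y \int[k y]_z (h z)%:E.
Proof.
have hE (m : {measure set Z -> \bar R}) : \int[m]_z (h z)%:E =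
    \sum_(r \in range h) r%:E * m (h @^-1` [set r]).
  under eq_integral do rewrite fimfunE -fsumEFin//.
  rewrite ge0_integral_fsum//; last 2 first.
    - by move=> r; exact/measurable_EFinP/measurableT_comp.
    - by move=> r z _; rewrite EFinM nnfun_muleindic_ge0.
  apply: eq_fsbigr => r _.
  rewrite (integralZl_indic _ (fun r => h @^-1` [set r]))//; last first.
    by move=> r0; rewrite preimage_nnfun0.
  by rewrite integral_indic// setIT.
rewrite hE.
under [RHS]eq_integral do rewrite hE.
rewrite ge0_integral_fsum//; last 2 first.
- by move=> r; apply: measurable_funeM; exact: mk.
- move=> r y _; have := mulemu_ge0 (fun r => h @^-1` [set r]).
  by apply; exact: preimage_nnfun0.
apply: eq_fsbigr => r _.
have [r0|r0] := leP 0%R r; first by rewrite ge0_integralZl//; exact: mk.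
by rewrite preimage_nnfun0// measure0 mule0 integral0_eq// => y _;
  rewrite measure0 mule0.
Qed.

Lemma integral_mixture (f : Z -> \bar R) :
  (forall z, 0 <= f z) -> measurable_fun setT f ->
  \int[mix]_z f z = \int[mu]_y \int[k y]_z f z.
Proof.
move=> f0 mf; pose h := nnsfun_approx measurableT mf.
have fE (m : {measure set Z -> \bar R}) :
    \int[m]_z f z = limn (fun n => \int[m]_z (h n z)%:E).
  rewrite -monotone_convergence//.
  - by apply: eq_integral => z _; apply/esym/cvg_lim => //;
    exact: cvg_nnsfun_approx.
  - by move=> n; exact/measurable_EFinP.
  - by move=> n z _; rewrite lee_fin.
  - by move=> z _ a b ab; rewrite lee_fin; exact/lefP/nd_nnsfun_approx.
have ndh (m : {measure set Z -> \bar R}) :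
    nondecreasing_seq (fun n => \int[m]_z (h n z)%:E).
  move=> i j ij; apply: ge0_le_integral => //.
  - by move=> z _; rewrite lee_fin.
  - exact/measurable_EFinP.
  - exact/measurable_EFinP.
  - by move=> z _; rewrite lee_fin; exact/lefP/nd_nnsfun_approx.
rewrite fE; under [X in limn X]eq_fun do rewrite integral_mixture_nnsfun.
under [RHS]eq_integral do rewrite fE.
rewrite monotone_convergence//.
- by move=> n; apply: measurable_fun_integral_kernel => //; [move=> z;
  rewrite lee_fin|exact/measurable_EFinP].
- by move=> n y _; apply: integral_ge0 => z _; rewrite lee_fin.
Qed.

End mixture.

Section density.
Context d (T : measurableType d) (R : realType).
Variables (nu : {measure set T -> \bar R}) (rho : T -> R).
Hypotheses (mrho : measurable_fun setT rho) (rho0 : forall x, 0 <= rho x).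
Local Open Scope ereal_scope.

Let weighted_dirac (x : T) : {measure set T -> \bar R} :=
  mscale (NngNum (rho0 x)) \d_x.

Let measurable_weighted_dirac (U : set T) : measurable U ->
  measurable_fun [set: T] (fun x => weighted_dirac x U).
Proof.
move=> mU; apply: emeasurable_funM; first exact/measurable_EFinP.
exact/measurable_EFinP.
Qed.

Definition density := mixture nu measurable_weighted_dirac.

HB.instance Definition _ := Measure.on density.

Lemma densityE (A : set T) : measurable A ->
  density A = \int[nu]_(x in A) (rho x)%:E.
Proof.
move=> mA; rewrite [RHS]integral_mkcond; apply: eq_integral => x _.
rewrite /weighted_dirac /= /mscale/= patchE diracE.
by case: ifPn => _; rewrite ?mule1// mule0.
Qed.

Lemma integral_density (f : T -> \bar R) :
  (forall x, 0 <= f x) -> measurable_fun setT f ->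
  \int[density]_x f x = \int[nu]_x ((rho x)%:E * f x).
Proof.
move=> f0 mf; rewrite integral_mixture//; apply: eq_integral => x _.
by rewrite ge0_integral_mscale//= integral_dirac// diracT mul1e.
Qed.

End density.

Section disintegration.
Context d d' (T0 : measurableType d) (T1 : measurableType d') (R : realType).
Variables (mu : probability T1 R) (k : R.-pker T1 ~> T0).
Variable P : probability (T0 * T1)%type R.
Hypothesis Pk : forall A B, measurable A -> measurable B ->
  P (A `*` B) = (\int[mu]_(x1 in B) k x1 A)%E.
Local Open Scope ereal_scope.

Let slice (x1 : T1) : {measure set (T0 * T1) -> \bar R}.
Proof.
apply: (pushforward (k x1) (fun x0 => (x0, x1)) : {measure set _ -> \bar R}).
exact: measurable_pair2.
Defined.

Let measurable_slice (U : set (T0 * T1)) : measurable U ->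
  measurable_fun [set: T1] (fun x1 => slice x1 U).
Proof.
move=> mU; have mswapU : measurable ((fun z : T1 * T0 => (z.2, z.1)) @^-1` U).
  rewrite -[X in measurable X]setTI.
  exact: (measurable_fun_pair measurable_snd measurable_fst).
have := @measurable_fun_xsection_finite_kernel _ _ _ _ _ k _ (mem_set mswapU).
apply: eq_measurable_fun => x1 _; congr (k x1 _).
by apply/seteqP; split => x0; rewrite /xsection/= inE.
Qed.

Let disintegrated_measure (U : set (T0 * T1)) : measurable U ->
  P U = mixture mu measurable_slice U.
Proof.
apply: (measure_unique [set A `*` B | A in measurable & B in measurable]
                       (fun=> setT)) => //.
- exact: measurable_prod_measurableType.
- move=> _ _ [A1 mA1 [B1 mB1 <-]] [A2 mA2 [B2 mB2 <-]].
  exists (A1 `&` A2); first exact: measurableI.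
  by exists (B1 `&` B2); [exact: measurableI|rewrite setXI].
- by move=> _; exists setT => //; exists setT => //; rewrite setXTT.
- by rewrite bigcup_const.
- move=> _ [A mA [B mB <-]]; apply: etrans (Pk mA mB) _.
  rewrite integral_mkcond.
  apply: eq_integral => x1 _; rewrite /= /pushforward patchE.
  case: ifPn => [/[!inE] Bx1|/negP]; [congr (k x1 _)|rewrite inE => Bx1].
    by apply/seteqP; split => x0 //= [].
  rewrite [X in k x1 X](_ : _ = set0) ?measure0//.
  by apply/seteqP; split => x0 //= [].
- by move=> _; apply: le_lt_trans (probability_le1 _ _) (ltry _).
Qed.

(** The two sides define measures that agree on rectangles. *)
Lemma integral_disintegration (f : T0 * T1 -> \bar R) :
  (forall z, 0 <= f z) -> measurable_fun setT f ->
  \int[P]_z f z = \int[mu]_x1 \int[k x1]_x0 f (x0, x1).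
Proof.
move=> f0 mf.
rewrite (eq_measure_integral (mixture mu measurable_slice)); last first.
  by move=> A mA _; exact: disintegrated_measure.
rewrite integral_mixture//; apply: eq_integral => x1 _.
by rewrite /slice ge0_integral_pushforward.
Qed.

End disintegration.

(** * Compact metric spaces as Borel spaces *)

Section borel_metric.
Context {R : realType} (X : pmetricType R).

Lemma open_borel (A : set X) : open A -> measurable (A : set (borel X)).
Proof. exact: sub_sigma_algebra. Qed.

Lemma continuous_borel (f : X -> R) : continuous f ->
  measurable_fun [set: borel X] (f : borel X -> R).
Proof.
move=> cf; apply: (measurability _ (RGenOpens.measurableE R)).
move=> _ [_ [a [b ->] <-]]; rewrite setTI; apply: open_borel.
by move/continuousP : cf; apply; exact: interval_open.
Qed.

Lemma lower_semicontinuous_borel (g : X -> \bar R) :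
  (forall a : R, open [set x | (a%:E < g x)%E]) ->
  measurable_fun [set: borel X] (g : borel X -> \bar R).
Proof.
move=> og; apply: (measurability _ (ErealGenOInfty.measurableE R)).
move=> _ [_ [a ->]] <-; rewrite setTI; apply: open_borel.
by rewrite preimage_itvoy; exact: og.
Qed.

Lemma lipschitz_continuous (f : X -> R) : lipschitz_fun f -> continuous f.
Proof.
move=> [L fL] x; apply/cvgrPdist_le => e e0.
have M0 : 0 < Num.max L 1 by rewrite lt_max ltr01 orbT.
near=> y; apply: le_trans (fL x y) _.
apply: (@le_trans _ _ (Num.max L 1 * mdist x y)).
  by rewrite ler_wpM2r ?mdist_ge0// le_max lexx.
rewrite mulrC -ler_pdivlMr//; apply: ltW.
have : ball x (e / Num.max L 1) y by near: y; apply: nbhsx_ballx;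
  rewrite divr_gt0.
by rewrite ballEmdist.
Unshelve. all: by end_near. Qed.

Lemma lipschitz_constant (f : X -> R) : lipschitz_fun f ->
  exists2 L, 0 <= L & forall x y, `|f x - f y| <= L * mdist x y.
Proof.
move=> [L fL]; exists `|L| => // x y; apply: le_trans (fL x y) _.
by rewrite ler_wpM2r ?mdist_ge0// ler_norm.
Qed.

Lemma lipschitz_mdist (x : X) : lipschitz_fun (mdist x).
Proof.
exists 1 => y z; rewrite mul1r ler_norml; apply/andP; split.
  have := metric_triangle x y z; lra.
by have := metric_triangle x z y; rewrite (metric_sym z); lra.
Qed.

Hypothesis cX : compact [set: X].

(** The distance is measurable for the product of the two Borel sigma-algebras
because a compact metric space has a countable basis: if the distance of [x] and
[y] is less than [r], this still holds between all points of a basic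
neighbourhood of [x] and all points near [y]. *)
Lemma measurable_mdist : measurable_fun [set: borel X * borel X]
  (fun p => mdist (p.1 : X) (p.2 : X)).
Proof.
apply: (measurability _ (RGenInftyO.measurableE R)).
move=> _ [_ [r ->]] <-; rewrite setTI.
have [B cB [oB bB]] := compact_second_countable cX.
pose F (b : set_type B) : set (borel X * borel X) := 
  (val b : set X) `*` ([set y | forall x, val b x -> mdist x y < r] : set X)°.
rewrite (_ : _ @^-1` _ = \bigcup_b F b).
  apply: countable_bigcupT_measurable => [|b].
    by rewrite (eq_countable (card_setT _)).
  apply: measurableX; apply: open_borel; last exact: open_interior.
  by apply: oB; exact: set_valP.
apply/seteqP; split => [[x y]|[x y] [b _ [/= bx /interior_subset yb]]];
  last first.
  by rewrite /= in_itv/= yb.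
rewrite /= in_itv/= => xyr.
pose e := (r - mdist x y) / 2.
have e0 : 0 < e by rewrite divr_gt0// subr_gt0.
have [b [Bb bx] be] := bB x _ (nbhsx_ballx x e e0).
exists (SigSub (mem_set Bb)) => //; split => //=.
apply: filterS (nbhsx_ballx y e e0) => y'.
rewrite ballEmdist/= => yy' x' /be; rewrite ballEmdist/= => xx'.
apply: le_lt_trans (metric_triangle x' x y') _.
have := metric_triangle x y y'; rewrite metric_sym in xx'.
by move: xx' yy'; rewrite /e; lra.
Qed.

Lemma compact_bounded_mdist : exists D : R, forall x y : X, mdist x y <= D.
Proof.
have cp : {within [set: X], continuous (mdist (point : X))}.
  apply: continuous_subspaceT; exact/lipschitz_continuous/lipschitz_mdist.
have [M [_ /(_ (M + 1))]] := compact_bounded (continuous_compact cp cX).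
rewrite ltrDl ltr01 => /(_ isT) bM; exists ((M + 1) + (M + 1)) => x y.
have pM (z : X) : mdist (point : X) z <= M + 1.
  by apply: le_trans (ler_norm _) (bM _ _); exists z.
by apply: le_trans (metric_triangle x (point : X) y) _; rewrite metric_sym lerD.
Qed.

Lemma lipschitz_bounded (f : X -> R) : lipschitz_fun f ->
  exists M, forall x, `|f x| <= M.
Proof.
move=> /lipschitz_constant[L L0 fL]; have [D DX] := compact_bounded_mdist.
exists (L * D + `|f point|) => x; rewrite -[f x](subrK (f point)).
apply: le_trans (ler_normD _ _) _; rewrite lerD2r.
by apply: le_trans (fL x point) _; rewrite ler_wpM2l.
Qed.

End borel_metric.

(** * The descending slope *)

Section slope.
Context {R : realType} (X : pmetricType R).
Implicit Types f g : X -> R.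
Local Open Scope ereal_scope.

Definition descent_rate f (x y : X) : R :=
  (Num.max (f x - f y) 0 / mdist x y)%R.

Lemma descent_rate_ge0 f x y : (0 <= descent_rate f x y)%R.
Proof. by rewrite divr_ge0 ?mdist_ge0// le_max lexx orbT. Qed.

Lemma descent_rate_diag f x : descent_rate f x x = 0%R.
Proof. by rewrite /descent_rate mdistxx invr0 mulr0. Qed.

(** The point [y = x] may be kept in the supremum: it contributes [0], as
division by [0] gives [0], and the other rates are nonnegative. Isolated points
then obey the same formula as all others. *)
Lemma descending_slopeE f x :
  descending_slope f x =
  ereal_inf [set ereal_sup [set (descent_rate f x y)%:E | y in ball x r]
            | r in [set r : R | (0 < r)%R]].
Proof.
have sup_ge0 (V : set X) : V x ->
    0 <= ereal_sup [set (descent_rate f x y)%:E | y in V].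
  move=> Vx; apply: ereal_sup_ubound; exists x => //=.
  by rewrite descent_rate_diag.
rewrite /descending_slope; case: asboolP => [[_ [V nV VE]]|nis].
  apply/eqP; rewrite eq_le; apply/andP; split.
    apply: le_ereal_inf_tmp => _ [r r0 <-].
    by apply: sup_ge0; exact: ballxx.
  move: nV; rewrite -nbhs_ballE => -[r r0 rV].
  apply: ge_ereal_inf; eexists; first by exists r.
  apply: ge_ereal_sup => _ [y /rV Vy <-].
  have : [set x] y by rewrite -VE.
  by move=> /= ->; rewrite descent_rate_diag.
rewrite limf_esupE; apply/eqP; rewrite eq_le; apply/andP; split.
  apply: le_ereal_inf_tmp => _ [r r0 <-].
  apply: ereal_inf_lbound; exists (ball x r) => //.
  by rewrite /dnbhs /within/=; apply: filterS (nbhsx_ballx x r r0).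
apply: le_ereal_inf_tmp => _ [V + <-].
rewrite /dnbhs /within/= -nbhs_ballE => -[r r0 rV].
have [y xy yx] : exists2 y, ball x r y & y != x.
  apply: contra_notP nis => /forall2NP h; split; first exact: in_setT.
  exists (ball x r); first exact: nbhsx_ballx.
  rewrite setIT; apply/seteqP; split => [y xy|_ ->]; last exact: ballxx.
  by have [//|/negP] := h y; rewrite negbK => /eqP.
apply: ge_ereal_inf; eexists; first by exists r.
apply: ge_ereal_sup => _ [z xz <-].
have [->|zx] := eqVneq z x; last by apply: ereal_sup_ubound; exists z => //;
  exact: rV.
rewrite descent_rate_diag; apply: (@le_trans _ _ (descent_rate f x y)%:E).
  by rewrite lee_fin descent_rate_ge0.
by apply: ereal_sup_ubound; exists y => //; exact: rV.
Qed.

Lemma descending_slope_ge0 f x : 0 <= descending_slope f x.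
Proof.
rewrite descending_slopeE; apply: le_ereal_inf_tmp => _ [r r0 <-].
apply: ereal_sup_ubound; exists x; first exact: ballxx.
by rewrite descent_rate_diag.
Qed.

Lemma descending_slope_le f g x :
  (forall y, descent_rate f x y <= descent_rate g x y)%R ->
  descending_slope f x <= descending_slope g x.
Proof.
move=> fg; rewrite !descending_slopeE; apply: le_ereal_inf_tmp => _ [r r0 <-].
apply: ge_ereal_inf; eexists; first by exists r.
apply: ge_ereal_sup => _ [y xy <-].
apply: le_ereal_sup_tmp; exists (descent_rate g x y)%:E; first by exists y.
by rewrite lee_fin.
Qed.

Lemma descending_slope_upper f x (e : \bar R) : descending_slope f x < e ->
  exists2 r, (0 < r)%R & forall y, ball x r y -> (descent_rate f x y)%:E <= e.
Proof.
rewrite descending_slopeE => /ereal_inf_lt[_ [r r0 <-] lte].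
exists r => // y xy; apply: le_trans (ltW lte).
by apply: ereal_sup_ubound; exists y.
Qed.

Lemma descent_rate_lipschitz f (L : R) x y : (0 <= L)%R ->
  (forall x y, `|f x - f y| <= L * mdist x y)%R -> (descent_rate f x y <= L)%R.
Proof.
move=> L0 fL; have [->|xy] := eqVneq x y; first by rewrite descent_rate_diag.
rewrite ler_pdivrMr ?mdist_gt0// ge_max mulr_ge0 ?mdist_ge0// andbT.
exact: le_trans (ler_norm _) (fL _ _).
Qed.

Lemma descending_slope_lipschitz f (L : R) x : (0 <= L)%R ->
  (forall x y, `|f x - f y| <= L * mdist x y)%R ->
  descending_slope f x <= L%:E.
Proof.
move=> L0 fL; rewrite descending_slopeE; apply: ge_ereal_inf; eexists.
  by exists 1%R => //=.
by apply: ge_ereal_sup => _ [y _ <-]; rewrite lee_fin descent_rate_lipschitz.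
Qed.

Lemma open_sublevel (g : X -> R) (c : R) : continuous g ->
  open [set x | (g x < c)%R].
Proof. by move=> /continuousP/(_ _ (@open_lt R c)). Qed.

(** On each scale the supremum of the rates is a lower semicontinuous function
of [x], and the slope is the infimum of these over countably many scales. *)
Lemma measurable_descending_slope f : continuous f ->
  measurable_fun [set: borel X] (descending_slope f : borel X -> \bar R).
Proof.
move=> cf.
pose S n (x : X) := ereal_sup [set (descent_rate f x y)%:E | y in ball x
  n.+1%:R^-1].
rewrite (_ : descending_slope f = fun x => einfs (S ^~ x) 0%N); last first.
  apply/funext => x; rewrite descending_slopeE; apply/eqP; rewrite eq_le.
  apply/andP; split; apply: le_ereal_inf_tmp.
    move=> _ [n _ <-]; apply: ereal_inf_lbound; exists n.+1%:R^-1%R => //=.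
  move=> _ [r r0 <-].
  have [n] := ltr_add_invr r0; rewrite add0r => /ltW nr.
  apply: ge_ereal_inf; eexists; first by exists n.
  apply: ereal_sup_le => _ [y xy <-]; exists y => //; exact: le_ball xy.
apply: measurable_fun_einfs => n.
apply: lower_semicontinuous_borel => a.
have [a0|a0] := ltP a 0%R.
  rewrite (_ : [set _ | _] = setT); first exact: openT.
  apply/seteqP; split => x // _ /=; apply: lt_le_trans (_ : 0 <= _).
    by rewrite lte_fin.
  apply: ereal_sup_ubound; exists x; first exact: ballxx.
  by rewrite descent_rate_diag.
rewrite (_ : [set _ | _] = \bigcup_y ([set x | (mdist y x < n.+1%:R^-1)%R] `&`
   [set x | (a * mdist y x - f x < - f y)%R])).
  apply: bigcup_open => y _; apply: openI.
    by apply: open_sublevel; exact/lipschitz_continuous/lipschitz_mdist.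
  apply: open_sublevel => x; apply: cvgB; last exact: cf.
  by apply: cvgMl_tmp; exact/lipschitz_continuous/lipschitz_mdist.
apply/seteqP; split => [x /= /ereal_sup_gt[_ [y xy <-]]|x [y _ /= [xy axy]]].
  rewrite lte_fin => aq; exists y => //=.
  have {}xy : (mdist y x < n.+1%:R^-1)%R by move: xy;
    rewrite ballEmdist/= metric_sym.
  split => //.
  have xy0 : (0 < mdist x y)%R.
    rewrite mdist_gt0; apply/eqP => xyE; move: aq.
    by rewrite xyE descent_rate_diag ltNge a0.
  move: aq; rewrite /descent_rate ltr_pdivlMr// lt_max => /orP[|].
    by rewrite metric_sym; lra.
  by rewrite ltNge mulr_ge0// mdist_ge0.
have aqy : (a * mdist x y < f x - f y)%R by rewrite metric_sym; lra.
have xy0 : (0 < mdist x y)%R.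
  rewrite mdist_gt0; apply/eqP => xyE; move: aqy.
  by rewrite xyE mdistxx mulr0 subrr ltxx.
apply: (@lt_le_trans _ _ (descent_rate f x y)%:E).
  by rewrite lte_fin /descent_rate ltr_pdivlMr// lt_max aqy.
apply: ereal_sup_ubound; exists y => //.
by rewrite ballEmdist/= metric_sym.
Qed.

Lemma fine_descending_slope_ge0 f x : (0 <= fine (descending_slope f x))%R.
Proof. by rewrite fine_ge0 ?descending_slope_ge0. Qed.

Lemma fin_num_descending_slope f x : lipschitz_fun f ->
  descending_slope f x \is a fin_num.
Proof.
move=> /lipschitz_constant[L L0 fL];
  rewrite ge0_fin_numE ?descending_slope_ge0//.
exact: le_lt_trans (descending_slope_lipschitz _ L0 fL) (ltry _).
Qed.

Lemma fine_descending_slope_le f (L : R) x : (0 <= L)%R ->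
  (forall x y, `|f x - f y| <= L * mdist x y)%R ->
  (fine (descending_slope f x) <= L)%R.
Proof.
move=> L0 fL; rewrite -lee_fin fineK ?descending_slope_lipschitz//.
by apply: fin_num_descending_slope; exists L.
Qed.

Lemma measurable_fine_descending_slope f : continuous f ->
  measurable_fun [set: borel X] (fun x : borel X =>
    fine (descending_slope f x)).
Proof.
move=> cf; apply: (measurableT_comp (fine_measurable measurableT)).
exact: measurable_descending_slope.
Qed.

End slope.

(** * Bounded functions on a probability space *)

Lemma norm_sqr_le (R : realDomainType) (v m : R) :
  0 <= v <= m -> `|v ^+ 2| <= m ^+ 2.
Proof.
move=> /andP[v0 vm].
by rewrite ger0_norm ?sqr_ge0// ler_sqr ?nnegrE// (le_trans v0).
Qed.

Section bounded_functions.
Context d (T : measurableType d) (R : realType) (P : probability T R).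
Variables (h : T -> R) (M : R).
Hypotheses (mh : measurable_fun setT h) (hM : forall x, `|h x| <= M).

Lemma bounded_integrable : P.-integrable setT (EFin \o h).
Proof.
apply: measurable_bounded_integrable => //.
  by rewrite -ge0_fin_numE ?fin_num_measure.
exists M; split; first by rewrite num_real.
by move=> y My x _ /=; exact: le_trans (hM x) (ltW My).
Qed.

Lemma EFin_bounded_Rintegral :
  (\int[P]_x (h x)%:E = (\int[P]_x h x)%R%:E)%E.
Proof.
by rewrite /Rintegral fineK//; exact: integrable_fin_num bounded_integrable.
Qed.

End bounded_functions.

Section reverse_fatou.
Context d (T : measurableType d) (R : realType) (P : probability T R).
Local Open Scope ereal_scope.

Lemma limn_einf_ge (u : nat -> \bar R) (l : \bar R) :
  (\forall n \near \oo, l <= u n) -> l <= limn_einf u.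
Proof.
move=> lu; rewrite /limn_einf /limn_esup leeNr limf_esupE.
apply: ge_ereal_inf; eexists; first by exists [set n | l <= u n].
by apply: ge_ereal_sup => _ [n lun <-]; rewrite leeN2.
Qed.

Lemma le_limn_einf (u w : nat -> \bar R) : (forall n, u n <= w n) ->
  limn_einf u <= limn_einf w.
Proof.
move=> uw; rewrite /limn_einf /limn_esup leeN2 !limf_esupE.
apply: le_ereal_inf_tmp => _ [V nV <-].
apply: ge_ereal_inf; eexists; first by exists V.
apply: ge_ereal_sup => _ [n Vn <-]; apply: le_ereal_sup_tmp.
by exists (- u n); [exists n|rewrite leeN2].
Qed.

Local Open Scope ring_scope.

(** Fatou's lemma for the nonnegative functions [C - F n]. Only an upper bound
on [F n] in the limit is assumed, not convergence. *)
Lemma reverse_fatou_bounded (F : nat -> T -> R) (S : T -> R) (v : nat -> R)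
    (C l : R) :
  (forall n, P.-integrable setT (EFin \o F n)) ->
  P.-integrable setT (EFin \o S) ->
  (forall n x, F n x <= C) -> (forall x, S x <= C) ->
  (forall x e, 0 < e -> \forall n \near \oo, F n x <= S x + e) ->
  (forall n, v n <= \int[P]_x F n x) ->
  v n @[n --> \oo] --> l -> l <= \int[P]_x S x.
Proof.
move=> iF iS FC SC FS vF vl.
have iC : P.-integrable setT (EFin \o (fun=> C : R)).
  by apply: finite_measure_integrable_cst.
have intC (g : T -> R) : P.-integrable setT (EFin \o g) ->
    (\int[P]_x (C - g x)%:E = (C - \int[P]_x g x)%:E)%E.
  move=> ig; rewrite -[RHS]/((C - _)%:E) -[X in (X - _)%:E]mulr1.
  rewrite -[X in (_ * X - _)%:E](_ : fine (P setT) = 1);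
    last by rewrite probability_setT.
  rewrite -(Rintegral_cst P measurableT) -RintegralB//.
  rewrite /Rintegral fineK//.
  exact: (integrable_fin_num measurableT (integrableB measurableT iC ig)).
have : (\int[P]_x (C - S x)%:E <= \int[P]_x limn_einf (fun n =>
  (C - F n x)%:E))%E.
  apply: ge0_le_integral_any => x; first by rewrite lee_fin subr_ge0.
  apply/lee_subgt0Pr => e e0; apply: limn_einf_ge.
  near=> n; rewrite lee_fin.
  have : F n x <= S x + e by near: n; exact: FS.
  by lra.
have CF0 n x : setT x -> (0 <= (C - F n x)%:E)%E by rewrite lee_fin subr_ge0.
have mCF n : measurable_fun setT (fun x => (C - F n x)%:E).
  by apply/measurable_EFinP/measurable_funB => //; apply/measurable_EFinP;
    case/integrableP: (iF n).
move=> /le_trans/(_ (fatou P measurableT mCF CF0)).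
have CvF n : (\int[P]_x (C - F n x)%:E <= (C - v n)%:E)%E.
  by rewrite intC// lee_fin lerD2l lerN2.
have Cv : (C - v n)%:E @[n --> \oo] --> (C - l)%:E.
  by apply: cvg_EFin; [near=> n|apply: cvgB => //; exact: cvg_cst].
move=> /le_trans/(_ (le_limn_einf CvF)).
by rewrite intC// (cvg_limn_einf_sup Cv).1 lee_fin lerD2l lerN2.
Unshelve. all: by end_near. Qed.
End reverse_fatou.

(** * First variation along a dynamical plan *)

Section first_variation.
Context {R : realType} (X : pmetricType R).
Hypothesis cX : compact [set: X].
Variable Pi : probability (borel (geodesic X)) R.
Local Notation geod := (borel (geodesic X)).
Local Notation ev t g := (geodesic_eval t (g : geod) : X).

Definition geodesic_start (g : geod) : X := ev 0%:i01 g.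

Definition geodesic_length (g : geod) : R :=
  mdist (geodesic_start g) (ev 1%:i01 g).

Lemma geodesic_eval_mdist (t : {i01 R}) (g : geod) :
  mdist (geodesic_start g) (ev t g) = t%:num * geodesic_length g.
Proof.
have /(_ 0%:i01 t) -> := set_valP (g : geodesic X).
by rewrite /= sub0r normrN ger0_norm.
Qed.

Lemma measurable_eval (phi : X -> R) (t : {i01 R}) :
  measurable_fun [set: borel X] (phi : borel X -> R) ->
  measurable_fun [set: geod] (fun g => phi (ev t g)).
Proof.
by move=> mphi; apply: measurableT_comp mphi (@geodesic_eval_measurable R X t).
Qed.

Lemma measurable_start (phi : X -> R) :
  measurable_fun [set: borel X] (phi : borel X -> R) ->
  measurable_fun [set: geod] (fun g => phi (geodesic_start g)).
Proof. exact: measurable_eval. Qed.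

Lemma measurable_geodesic_length : measurable_fun [set: geod] geodesic_length.
Proof.
exact: (measurableT_comp (measurable_mdist cX) (@geodesic_ends_measurable R X)).
Qed.

(** The weight [kappa] is chosen so that the first term on the right cancels
the gain from curvature. *)
Lemma young_along_plan (u : X -> R) (m p kappa : R) :
  0 < kappa -> measurable_fun [set: borel X] (u : borel X -> R) ->
  (forall x, 0 <= u x <= m) ->
  p * \int[Pi]_g (u (geodesic_start g) * geodesic_length g) <=
  kappa * \int[Pi]_g (geodesic_length g ^+ 2) +
  p ^+ 2 / (4 * kappa) * \int[Pi]_g (u (geodesic_start g) ^+ 2).
Proof.
move=> kappa0 mu um; have [D DX] := compact_bounded_mdist cX.
have len g : 0 <= geodesic_length g <= D by rewrite mdist_ge0 DX.
have mlen := measurable_geodesic_length.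
have mus := measurable_start mu.
have ilen2 : Pi.-integrable setT (EFin \o (fun g => geodesic_length g ^+ 2)).
  apply: (@bounded_integrable _ _ _ Pi _ (D ^+ 2));
    first exact: measurable_funX.
  by move=> g; exact: norm_sqr_le.
have iu2 : Pi.-integrable setT (EFin \o (fun g => u (geodesic_start g) ^+ 2)).
  apply: (@bounded_integrable _ _ _ Pi _ (m ^+ 2));
    first exact: measurable_funX.
  by move=> g; exact: norm_sqr_le.
have iul : Pi.-integrable setT
    (EFin \o (fun g => u (geodesic_start g) * geodesic_length g)).
  apply: (@bounded_integrable _ _ _ Pi _ (m * D)); first exact: measurable_funM.
  move=> g; have /andP[u0 u1] := um (geodesic_start g); have /andP[l0 l1] :=
    len g.
  by rewrite ger0_norm; [apply: ler_pM|apply: mulr_ge0].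
rewrite -!RintegralZl// -RintegralD//; last 2 first.
- exact: (integrableZl measurableT kappa ilen2).
- exact: (integrableZl measurableT (p ^+ 2 / (4 * kappa)) iu2).
apply: le_Rintegral => //.
- exact: (integrableZl measurableT p iul).
- exact: (integrableD measurableT (integrableZl measurableT kappa ilen2)
    (integrableZl measurableT (p ^+ 2 / (4 * kappa)) iu2)).
move=> g _; move: (u _) (geodesic_length g) => v l.
rewrite -subr_ge0 (_ : _ - _ = kappa * (l - p / (2 * kappa) * v) ^+ 2).
  by apply: mulr_ge0; [exact: ltW|exact: sqr_ge0].
by field; rewrite gt_eqF.
Qed.

(** The difference quotients of [psi] along a geodesic are at most [w] at time
[t n], times the rate of descent of [f] from the starting point to the point
at time [t n], times the length; [w] is continuous, and the descending slope
dominates the rate in the limit. *)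
Lemma first_variation (f psi w : X -> R) (L M W l : R)
    (t : nat -> {i01 R}) (v : nat -> R) :
  0 <= L -> (forall x y, `|f x - f y| <= L * mdist x y) ->
  measurable_fun [set: borel X] (psi : borel X -> R) ->
  (forall x, `|psi x| <= M) ->
  continuous w -> (forall x, 0 <= w x <= W) ->
  (forall x y, psi y - psi x <= w y * Num.max (f x - f y) 0) ->
  (forall n, 0 < (t n)%:num) -> (t n)%:num @[n --> \oo] --> 0 ->
  (forall n, (t n)%:num * v n <=
    \int[Pi]_g (psi (ev (t n) g) - psi (geodesic_start g))) ->
  v n @[n --> \oo] --> l ->
  l <= \int[Pi]_g (w (geodesic_start g) *
                   fine (descending_slope f (geodesic_start g)) *
                   geodesic_length g).
Proof.
move=> L0 fL mpsi psiM cw wW psiw t0 tto0 vt vl.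
have [D DX] := compact_bounded_mdist cX.
have D0 : 0 <= D by apply: le_trans (DX point point); exact: mdist_ge0.
have W0 : 0 <= W by have /andP[] := wW point; exact: le_trans.
have cf : continuous f by apply: lipschitz_continuous; exists L.
have len0 g : 0 <= geodesic_length g by exact: mdist_ge0.
have slope_fin x : descending_slope f x \is a fin_num.
  by apply: fin_num_descending_slope; exists L.
have slope0 := fine_descending_slope_ge0 f.
have slopeL x := fine_descending_slope_le x L0 fL.
pose F n (g : geod) := (psi (ev (t n) g) - psi (geodesic_start g)) / (t n)%:num.
have iF n : Pi.-integrable setT (EFin \o F n).
  apply: (@bounded_integrable _ _ _ Pi _ ((M + M) / (t n)%:num)).
    apply: measurable_funM => //; apply: measurable_funB;
      [exact: measurable_eval|exact: measurable_start].
  move=> g; rewrite normrM normfV [X in _ / X]gtr0_norm//.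
  rewrite ler_wpM2r ?invr_ge0 ?(ltW (t0 n))//.
  by apply: le_trans (ler_normB _ _) _; rewrite lerD.
have Frate n g : F n g <=
    w (ev (t n) g) * descent_rate f (geodesic_start g) (ev (t n) g) *
    geodesic_length g.
  rewrite /F ler_pdivrMr//; apply: le_trans (psiw _ _) _.
  rewrite -!mulrA [geodesic_length g * _]mulrC -geodesic_eval_mdist.
  have [-> |yx] := eqVneq (ev (t n) g) (geodesic_start g).
    by rewrite mdistxx subrr maxxx !mulr0.
  by rewrite mulVf ?mulr1// gt_eqF// mdist_gt0 eq_sym.
apply: (@reverse_fatou_bounded _ _ _ Pi F _ v (W * L * D) l) => //.
- apply: (@bounded_integrable _ _ _ Pi _ (W * L * D)).
    apply: measurable_funM; last exact: measurable_geodesic_length.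
    apply: measurable_funM.
      exact: (measurable_start (continuous_borel cw)).
    exact: (measurable_start (measurable_fine_descending_slope cf)).
  move=> g; have /andP[w0 w1] := wW (geodesic_start g).
  rewrite ger0_norm; last by rewrite !mulr_ge0 ?slope0.
  by apply: ler_pM => //; [rewrite mulr_ge0 ?slope0|exact: ler_pM|exact: DX].
- move=> n g; apply: le_trans (Frate n g) _.
  have /andP[w0 w1] := wW (ev (t n) g).
  apply: ler_pM => //; [by rewrite mulr_ge0 ?descent_rate_ge0| |exact: DX].
  apply: ler_pM => //; first exact: descent_rate_ge0.
  exact: descent_rate_lipschitz.
- move=> g; have /andP[w0 w1] := wW (geodesic_start g).
  by apply: ler_pM => //; [rewrite mulr_ge0 ?slope0|exact: ler_pM|exact: DX].
- move=> g e e0; set x := geodesic_start g.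
  set s := fine _; have s0 : 0 <= s by exact: slope0.
  have /andP[wx0 _] := wW x.
  (* (w + delta) (s + delta) length <= w s length + e for this delta. *)
  pose del := Num.min 1 (e / ((w x + s + 1) * (geodesic_length g + 1))).
  have den0 : 0 < (w x + s + 1) * (geodesic_length g + 1).
    by rewrite mulr_gt0// ltr_wpDl// addr_ge0.
  have del0 : 0 < del by rewrite lt_min ltr01 divr_gt0.
  have del1 : del <= 1 by rewrite ge_min lexx.
  have dele : del * ((w x + s + 1) * (geodesic_length g + 1)) <= e.
    by rewrite -ler_pdivlMr// ge_min lexx orbT.
  have [r r0 rs] : exists2 r, 0 < r &
      forall y, ball x r y -> ((descent_rate f x y)%:E <= (s + del)%:E)%E.
    apply: descending_slope_upper; rewrite -(fineK (slope_fin x)) lte_fin.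
    by rewrite ltrDl.
  have := cw x; move=> /cvgrPdist_le/(_ _ del0).
  rewrite -nbhs_ballE => -[r' r'0 wr'].
  have [rr0 rr1 rr2] : [/\ 0 < Num.min r r', Num.min r r' <=
    r & Num.min r r' <= r'].
    by rewrite lt_min r0 r'0 !ge_min !lexx orbT.
  have := tto0 => /cvgrPdist_lt/(_ (Num.min r r' / (D + 1))).
  rewrite divr_gt0 ?ltr_wpDl// => /(_ isT); apply: filterS => n.
  rewrite sub0r normrN gtr0_norm// ltr_pdivlMr ?ltr_wpDl// => tn.
  have dxy : mdist x (ev (t n) g) < Num.min r r'.
    rewrite geodesic_eval_mdist; apply: le_lt_trans tn.
    by rewrite ler_wpM2l// ler_wpDr// DX.
  have /rs : ball x r (ev (t n) g).
    by rewrite ballEmdist/=; apply: lt_le_trans rr1.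
  have /wr' : ball x r' (ev (t n) g).
    by rewrite ballEmdist/=; apply: lt_le_trans rr2.
  rewrite /= lee_fin ler_distlC => /andP[_ wy] ry.
  apply: le_trans (Frate n g) _.
  have /andP[wy0 _] := wW (ev (t n) g).
  have wyry := ler_pM wy0 (descent_rate_ge0 f x _) wy ry.
  apply: le_trans (ler_wpM2r (len0 g) wyry) _.
  set len := geodesic_length g in den0 dele *.
  apply: (@le_trans _ _ (w x * s * len + del * ((w x + s + 1) * (len + 1)))).
    rewrite [leLHS](_ : _ = w x * s * len + del * ((w x + s + del) * len));
      last by ring.
    rewrite lerD2l ler_pM2l// ler_pM ?addr_ge0 ?(ltW del0) ?len0// ?lerD2l//.
    by rewrite lerDl.
  by rewrite lerD2l.
- move=> n; rewrite /F.
  have im : Pi.-integrable setT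
      (EFin \o fun g => psi (ev (t n) g) - psi (geodesic_start g)).
    apply: (@bounded_integrable _ _ _ Pi _ (M + M)).
      apply: measurable_funB; first exact: measurable_eval.
      exact: measurable_start.
    by move=> g; apply: le_trans (ler_normB _ _) _; rewrite lerD.
  by rewrite RintegralZr// ler_pdivlMr// mulrC.
Qed.

End first_variation.

(** * Displacement convexity towards the reference measure *)

Section displacement.
Context {R : realType} (X : pmetricType R).
Variables (nu : probability (borel X) R) (K N : R).
Hypotheses (N2 : 2 < N) (K0 : 0 < K) (cX : compact [set: X]).
Hypothesis ricci : ricci_bounded_below nu N K.
Variables (rho : X -> R) (c M : R).
Hypotheses (crho : continuous rho) (c0 : 0 < c) (rho_bnd : forall x, c <=
  rho x <= M).
Hypothesis rho1 : (\int[nu]_x (rho x)%:E = 1)%E.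

Local Notation p := (1 - N^-1).
Local Notation psi := (fun x : X => rho x `^ (p - 1)).
Local Notation kappa := (K / (6 * N)).

Let rho_gt0 x : 0 < rho x.
Proof. by apply: lt_le_trans c0 _; case/andP: (rho_bnd x). Qed.

Let rho_ge0 x : 0 <= rho x. Proof. exact: ltW. Qed.

Let mrho : measurable_fun [set: borel X] (rho : borel X -> R).
Proof. exact: continuous_borel. Qed.

Let mpow r : measurable_fun [set: borel X] ((fun x =>
  rho x `^ r) : borel X -> R).
Proof. exact: (measurableT_comp (measurable_powR r) mrho). Qed.

Let p01 : 0 < p < 1.
Proof.
have N0 : 0 < N by apply: lt_trans N2.
by rewrite subr_gt0 invf_lt1// gtrBl invr_gt0 N0 andbT (lt_trans _ N2)// ltr1n.
Qed.

Let N1 : 1 < N. Proof. by apply: lt_trans N2; rewrite ltr1n. Qed.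

Let powM r : 0 <= r -> forall x, rho x `^ r <= M `^ r.
Proof.
move=> r0 x; have /andP[_ rM] := rho_bnd x.
by rewrite ge0_ler_powR// nnegrE// (le_trans (rho_ge0 x)).
Qed.

Let psi_bnd x : `|psi x| <= c `^ (p - 1).
Proof.
have /andP[cr _] := rho_bnd x; rewrite ger0_norm ?powR_ge0//.
rewrite -opprB !powRN lef_pV2 ?posrE ?powR_gt0//
  ge0_ler_powR ?nnegrE ?(ltW c0)//.
by rewrite subr_ge0 ltW//; case/andP: p01.
Qed.

(** The first clause is the law of the starting point, which has density [rho].
The second is the convexity inequality at time [t] for [U r = - r ^ p] between
[rho nu] and [nu], with the distortion coefficients bounded below and the
functional at time [t] replaced by its linearization at [rho]. *)
Lemma concavity_along_plan : exists Pi : probability (borel (geodesic X)) R,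
  (forall phi : X -> R, measurable_fun [set: borel X] (phi : borel X -> R) ->
    (forall x, 0 <= phi x) ->
    (\int[Pi]_g (phi (geodesic_start g))%:E =
     \int[nu]_x (rho x * phi x)%:E)%E) /\
  forall t : {i01 R}, 0 < t%:num < 1 ->
    t%:num *
    (1 + kappa * (1 - t%:num ^+ 2) * \int[Pi]_g (geodesic_length g ^+ 2) -
     \int[nu]_x (rho x `^ p)) <=
    p * \int[Pi]_g (psi (geodesic_eval t g) - psi (geodesic_start g)).
Proof.
have m01 : density nu mrho rho_ge0 setT = 1%E by rewrite densityE.
pose mu0 : probability (borel X) R :=
  HB.pack (density nu mrho rho_ge0)
    (Measure_isProbability.Build _ _ _ (density nu mrho rho_ge0) m01).
have mu0E A : mu0 A = density nu mrho rho_ge0 A by [].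
clearbody mu0.
have dec0 : lebesgue_decomposition nu mu0 rho mzero.
  split=> //; first by exists set0; split => //; rewrite measure0.
  by move=> A mA; rewrite /mzero adde0 mu0E densityE.
have dec1 : lebesgue_decomposition nu nu (cst 1) mzero.
  split=> //; first by exists set0; split => //; rewrite measure0.
  by move=> A mA; rewrite /mzero adde0; have := integral_cst nu mA 1%E;
    rewrite mul1e => <-.
have supp0 : measure_support mu0 `<=` measure_support nu.
  move=> x xmu V oV Vx; rewrite lt0e measure_ge0 andbT.
  apply/negP => /eqP nuV; have := xmu V oV Vx.
  rewrite mu0E densityE; last exact: open_borel.
  rewrite null_set_integral ?ltxx//; first exact: open_borel.
  by apply/measurable_EFinP; apply: measurable_funTS.
have [Pi [[tp _] [k0 [k1 [dis0 dis1 convexity]]]]] :=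
  ricci supp0 (@subset_refl _ _) dec0 dec1.
exists Pi.
have start_law (phi : X -> R) :
    measurable_fun [set: borel X] (phi : borel X -> R) ->
    (forall x, 0 <= phi x) ->
    (\int[Pi]_g (phi (geodesic_start g))%:E = \int[nu]_x (rho x * phi x)%:E)%E.
  move=> mphi phi0.
  transitivity (\int[distribution Pi (geodesic_eval 0%R%:i01)]_x (phi x)%:E)%E.
    by rewrite ge0_integral_distribution//; exact/measurable_EFinP.
  rewrite (eq_measure_integral (density nu mrho rho_ge0)); last first.
    move=> A mA _; have [mu0A _] := tp A mA; apply: etrans (mu0E A);
      rewrite -mu0A.
    rewrite /distribution /pushforward/=; congr (Pi _).
    by apply/seteqP; split => g //= [].
  by rewrite integral_density//; exact/measurable_EFinP.
split=> // t /andP[t0 t1].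
have [rhot [must [dect Hconv]]] := convexity t.
have {}Hconv := Hconv _ (DC_opp_powR N1).
have s0 : 0 <= 1 - t%:num by rewrite subr_ge0 ltW.
pose b := kappa * (1 - t%:num ^+ 2).
have b0 : 0 <= b.
  have N0 : 0 <= N by rewrite ltW// (lt_trans _ N1).
  by rewrite mulr_ge0 ?divr_ge0 ?mulr_ge0 ?(ltW K0)// subr_ge0 expr_le1 ?ltW.
pose A := \int[nu]_x (rho x `^ p).
pose B := \int[Pi]_g (geodesic_length g ^+ 2).
have powp_bnd x : `|rho x `^ p| <= M `^ p.
  by rewrite ger0_norm ?powR_ge0// powM// ltW//; case/andP: p01.
have AE : (\int[nu]_x (rho x `^ p)%:E = A%:E)%E.
  by rewrite (EFin_bounded_Rintegral nu (mpow p) powp_bnd).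
have [D DX] := compact_bounded_mdist cX.
have mlen2 : measurable_fun setT (fun g : borel (geodesic X) =>
  geodesic_length g ^+ 2).
  by apply: measurable_funX; exact: measurable_geodesic_length.
have len2_bnd g : `|geodesic_length (X := X) g ^+ 2| <= D ^+ 2.
  rewrite ger0_norm ?sqr_ge0// ler_sqr ?nnegrE ?mdist_ge0// ?DX//.
  exact: le_trans (mdist_ge0 _ _) (DX point point).
have BE : (\int[Pi]_g (1 + b * geodesic_length g ^+ 2)%:E = (1 + b * B)%:E)%E.
  have iB := bounded_integrable Pi mlen2 len2_bnd.
  rewrite (@EFin_bounded_Rintegral _ _ _ Pi _ (1 + b * D ^+ 2)); last 2 first.
  - by apply: measurable_funD => //; exact: measurable_funM.
  - move=> g; rewrite ger0_norm; last first.
      by apply: addr_ge0 => //; apply: mulr_ge0 => //; exact: sqr_ge0.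
    by rewrite lerD2l ler_wpM2l// -[leLHS]ger0_norm ?sqr_ge0.
  rewrite RintegralD//; last 2 first.
  - exact: finite_measure_integrable_cst.
  - exact: (integrableZl measurableT b iB).
  rewrite RintegralZl// Rintegral_cst// [X in fine X]probability_setT mulr1//.
have mpsit (s : {i01 R}) := measurable_eval s (mpow (p - 1)).
have psit_bnd (s : {i01 R}) (g : borel (geodesic X)) :=
  psi_bnd (geodesic_eval s g).
have psi_integrable s := bounded_integrable Pi (mpsit s) (psit_bnd s).
have psiE s := EFin_bounded_Rintegral Pi (mpsit s) (psit_bnd s).
have P0E : \int[Pi]_g (psi (geodesic_start g)) = A.
  apply: EFin_inj; rewrite -AE -[LHS]psiE.
  rewrite (start_law psi (mpow (p - 1)))//; last by move=> x; exact: powR_ge0.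
  by apply: eq_integral => x _; rewrite mulr_powRB1//; case/andP: p01.
(* The first term of the bound only uses that beta is at least 1; the gain from
curvature comes from the second term. *)
have lower : ((((1 - t%:num) * A + t%:num * (1 + b * B))%:E
    <= \int[nu]_x (rhot x `^ p)%:E)%E).
  move: Hconv; rewrite /U_functional /distorted_bound slope_at_infty_opp_powR//.
  rewrite !mul0e !adde0 => Hconv.
  rewrite -leeN2 -integral_ge0N; last by move=> x _; rewrite lee_fin powR_ge0.
  apply: le_trans Hconv _.
  rewrite [leRHS](_ : _ = ((1 - t%:num)%:E * - A%:E +
                           t%:num%:E * - (1 + b * B)%:E)%E); last first.
    by rewrite -!EFinN -!EFinM -EFinD; congr EFin; ring.
  apply: leeD; apply: lee_wpmul2l; rewrite ?lee_fin//.
  - rewrite -AE; apply: integral_le_opp => x0.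
      by rewrite lee_fin powR_ge0.
    have -> : ((rho x0 `^ p)%:E = \int[k0 x0]_x1 cst (rho x0 `^ p)%:E x1)%E.
      by rewrite integral_cst// prob_kernel mule1.
    apply: integral_le_opp => x1; first by rewrite /= lee_fin powR_ge0.
    have s01 : 0 < 1 - t%:num < 1 by rewrite subr_gt0 t1 gtrBl t0.
    apply: le_trans
      (perspective_beta_le N2 K0 s01 (mdist_ge0 _ _) (rho_gt0 _)) _.
    rewrite lee_fin lerN2 ler_peMl ?powR_ge0// lerDl.
    case/andP: s01 => s1 s2; have N0 : 0 <= N by rewrite ltW// (lt_trans _ N1).
    by rewrite mulr_ge0 ?sqr_ge0// mulr_ge0 ?divr_ge0 ?mulr_ge0 ?(ltW K0)//
      subr_ge0 expr_le1 ?ltW.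
  - have -> : ((1 + b * B)%:E = \int[nu]_x1 \int[k1 x1]_x0
        (1 + b * mdist (x0 : X) (x1 : X) ^+ 2)%:E)%E.
      rewrite -BE; pose h (z : borel X * borel X) : \bar R :=
        (1 + b * mdist (z.1 : X) (z.2 : X) ^+ 2)%:E.
      have h0 z : (0 <= h z)%E by rewrite lee_fin addr_ge0// mulr_ge0// sqr_ge0.
      have mh : measurable_fun setT h.
        apply/measurable_EFinP; apply: measurable_funD => //.
        apply: measurable_funM => //; apply: measurable_funX.
        exact: measurable_mdist.
      rewrite -[RHS](integral_disintegration dis1 h0 mh).
      by rewrite ge0_integral_distribution.
    apply: integral_le_opp => x1.
      apply: integral_ge0 => x0 _.
      by rewrite lee_fin addr_ge0// mulr_ge0// sqr_ge0.
    apply: integral_le_opp => x0.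
      by rewrite lee_fin addr_ge0// mulr_ge0// sqr_ge0.
    have t01 : 0 < t%:num < 1 by rewrite t0.
    apply: le_trans (perspective_beta_le N2 K0 t01 (mdist_ge0 _ _) ltr01) _.
    by rewrite powR1 mulr1 /b.
(* The tangent line of r ^ p at rho makes the functional at time t linear in
rhot; adding the singular part then only increases the integral of psi. *)
have upper : (\int[nu]_x (rhot x `^ p)%:E <=
    (p * \int[Pi]_g (psi (geodesic_eval t g)) + (1 - p) * A)%:E)%E.
  have [mrhot rhot0 _ rhotE] := dect.
  have /andP[p0 p1] := p01; have q0 : 0 <= 1 - p by rewrite subr_ge0 ltW.
  apply: (@le_trans _ _ (\int[nu]_x (p%:E * ((rhot x)%:E * (psi x)%:E) +
                                     (1 - p)%:E * (rho x `^ p)%:E))%E).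
    apply: ge0_le_integral_any => x; first by rewrite lee_fin powR_ge0.
    rewrite -!EFinM -EFinD lee_fin mulrA.
    exact: powR_tangent p01 (rhot0 x) (rho_gt0 x).
  have rhotpsi0 x : (0 <= (rhot x)%:E * (psi x)%:E)%E.
    by rewrite -EFinM lee_fin mulr_ge0 ?powR_ge0.
  have mrhotpsi : measurable_fun setT (fun x : borel X =>
    (rhot x)%:E * (psi x)%:E)%E.
    by apply: emeasurable_funM; apply/measurable_EFinP => //; exact: mpow.
  rewrite ge0_integralD//; last 4 first.
  - by move=> x _; rewrite mule_ge0// lee_fin ltW.
  - exact: emeasurable_funM.
  - by move=> x _; rewrite mule_ge0// lee_fin ?powR_ge0.
  - by apply: emeasurable_funM => //; apply/measurable_EFinP; exact: mpow.
  rewrite !ge0_integralZl//; last 3 first.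
  - by apply/measurable_EFinP; exact: mpow.
  - by move=> x _; rewrite lee_fin ?powR_ge0.
  - by rewrite lee_fin ltW.
  rewrite AE [leRHS]EFinD !EFinM leeD2r// lee_wpmul2l ?lee_fin ?(ltW p0)//.
  rewrite -psiE -integral_density//; last 2 first.
  - by move=> x; rewrite lee_fin powR_ge0.
  - by apply/measurable_EFinP; exact: mpow.
  have mpsi : measurable_fun setT (fun x : borel X => (psi x)%:E).
    by apply/measurable_EFinP; exact: mpow.
  have psi0 x : (0 <= (psi x)%:E)%E by rewrite lee_fin powR_ge0.
  apply: (@le_trans _ _
    (\int[measure_add (density nu mrhot rhot0) must]_x (psi x)%:E)%E).
    by rewrite ge0_integral_measure_add// leeDl// integral_ge0.
  rewrite (eq_measure_integral (distribution Pi (geodesic_eval t))); last first.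
    move=> S mS _; apply: esym; apply: etrans (rhotE S mS) _.
    by rewrite -(densityE nu mrhot rhot0 mS) -measure_addE.
  by rewrite ge0_integral_distribution.
rewrite RintegralB//; last exact: psi_integrable.
rewrite P0E; move: (le_trans lower upper); rewrite lee_fin -/A -/B -/b.
by lra.
Qed.

End displacement.

(** * Interpolation between Lebesgue norms *)

Section interpolation.
Context d (T : measurableType d) (R : realType) (P : probability T R).

(** Hoelder's inequality: with [I] the integral of [h], integrate the weighted
arithmetic-geometric mean inequality for [h / I] and [h ^ q], both of which have
integral [1]. *)
Lemma Rintegral_interpolation (h : T -> R) (M th q : R) :
  measurable_fun setT h -> (forall x, 0 <= h x <= M) ->
  0 < th < 1 -> 0 < q -> \int[P]_x (h x `^ q) = 1 -> 0 < \int[P]_x h x ->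
  \int[P]_x (h x `^ (th + (1 - th) * q)) <= (\int[P]_x h x) `^ th.
Proof.
move=> mh hM th01 q0 hq I0; set I := \int[P]_x h x in I0 *.
have h0 x : 0 <= h x by case/andP: (hM x).
have ih : P.-integrable setT (EFin \o h).
  by apply: (@bounded_integrable _ _ _ P _ M) => // x; rewrite ger0_norm//;
    case/andP: (hM x).
have ipow r : 0 <= r -> P.-integrable setT (EFin \o (fun x => h x `^ r)).
  move=> r0; apply: (@bounded_integrable _ _ _ P _ (M `^ r)).
    exact: (measurableT_comp (measurable_powR r) mh).
  move=> x; have /andP[_ hMx] := hM x.
  by rewrite ger0_norm ?powR_ge0// ge0_ler_powR ?nnegrE// (le_trans (h0 x)).
have /andP[th0 th1] := th01.
have thq0 : 0 <= th + (1 - th) * q by rewrite addr_ge0 ?mulr_ge0 ?subr_ge0 ?ltW.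
have rhs_int : P.-integrable setT
    (EFin \o (fun x => th / I * h x + (1 - th) * h x `^ q)).
  exact: (integrableD measurableT (integrableZl measurableT (th / I) ih)
    (integrableZl measurableT (1 - th) (ipow _ (ltW q0)))).
have -> : I `^ th = \int[P]_x (I `^ th * (th / I * h x + (1 - th) * h x `^ q)).
  rewrite RintegralZl// RintegralD//; last 2 first.
  - exact: (integrableZl measurableT _ ih).
  - exact: (integrableZl measurableT _ (ipow _ (ltW q0))).
  rewrite RintegralZl// RintegralZl//; last by apply: ipow; exact: ltW.
  by rewrite hq -/I divfK ?gt_eqF// mulr1 addrC subrK mulr1.
apply: le_Rintegral => //; [exact: ipow|exact: (integrableZl measurableT _
  rhs_int)|].
move=> x _.
have -> : h x `^ (th + (1 - th) * q) = I `^ th * ((h x / I) `^ th * (h x `^ q)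
  `^ (1 - th)).
  rewrite mulrA -powRM ?divr_ge0 ?(ltW I0)//.
  rewrite mulrC [_ / _ ]mulrC mulrA mulfV ?gt_eqF// mul1r -powRrM [q * _]mulrC.
  have [->|hx] := eqVneq (h x) 0.
    have r0 : th + (1 - th) * q != 0 by rewrite gt_eqF//
      addr_gt0 ?mulr_gt0 ?subr_gt0.
    by rewrite (powR0 r0) [0 `^ th]powR0 ?mul0r// gt_eqF.
  rewrite powRD; last by apply/implyP.
  by [].
rewrite ler_wpM2l ?powR_ge0//.
rewrite (_ : th / I * h x = th * (h x / I)); last by ring.
by apply: powR_weighted_AMGM => //; rewrite ?powR_ge0// divr_ge0 ?(ltW I0).
Qed.
End interpolation.

(** * The Sobolev inequality *)

Section sobolev.
Context {R : realType} (X : pmetricType R).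
Variables (nu : probability (borel X) R) (K N : R).
Hypotheses (N2 : 2 < N) (K0 : 0 < K) (cX : compact [set: X]).
Hypothesis ricci : ricci_bounded_below nu N K.

Local Notation p := (1 - N^-1).
Local Notation q := (2 * N / (N - 2)).

(** Positivity of [f] makes [f ^ (- 2 / (N - 2))] a bounded function, to which
[first_variation] applies. *)
Lemma sobolev_positive (f : X -> R) (c : R) : lipschitz_fun f ->
  0 < c -> (forall x, c <= f x) -> \int[nu]_x (f x `^ q) = 1 ->
  1 <= \int[nu]_x (f x `^ (q * p)) +
       6 / (K * N) * ((N - 1) / (N - 2)) ^+ 2 *
       \int[nu]_x (fine (descending_slope f x) ^+ 2).
Proof.
move=> lf c0 cf fq1.
have [L L0 fL] := lipschitz_constant lf.
have [M fM] := lipschitz_bounded cX lf.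
have f0 x : 0 < f x by exact: lt_le_trans (cf x).
have contf := lipschitz_continuous lf.
have ms := measurable_fine_descending_slope contf.
have s0 := fine_descending_slope_ge0 f.
have sL x := fine_descending_slope_le x L0 fL.
have [N0 N20 N10] : [/\ 0 < N, 0 < N - 2 & 0 < N - 1] by have := N2; split; lra.
have q0 : 0 < q by rewrite divr_gt0// mulr_gt0.
have cpow r : continuous (fun x => f x `^ r).
  move=> x; exact: (continuous_comp (contf x) (powR_continuous_at (f0 x))).
pose rho x := f x `^ q.
have rho_bnd x : c `^ q <= rho x <= M `^ q.
  have fMx : f x <= M by exact: le_trans (ler_norm _) (fM x).
  by rewrite !ge0_ler_powR ?nnegrE ?(ltW q0) ?(ltW c0) ?(ltW (f0 x))//
    (le_trans (ltW (f0 x))).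
have mf r : measurable_fun [set: borel X] ((fun x => f x `^ r) : borel X -> R).
  exact: continuous_borel.
have rho1 : (\int[nu]_x (rho x)%:E = 1)%E.
  rewrite (@EFin_bounded_Rintegral _ _ _ nu _ (M `^ q)) ?fq1//; first exact: mf.
  by move=> x; rewrite ger0_norm ?powR_ge0//; case/andP: (rho_bnd x).
have [Pi [start_law ineq]] :=
  concavity_along_plan N2 K0 cX ricci (cpow q) (powR_gt0 q c0) rho_bnd rho1.
pose a := 2 / (N - 2).
have a0 : 0 < a by rewrite divr_gt0.
pose w x := a * f x `^ (- a - 1).
have w0 x : 0 <= w x by rewrite mulr_ge0 ?powR_ge0 ?ltW.
pose psi x := rho x `^ (p - 1).
have psiE x : psi x = f x `^ (- a).
  rewrite /psi /rho -powRrM; congr (_ `^ _).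
  by rewrite /a; field; rewrite !gt_eqF.
have wW x : 0 <= w x <= a * c `^ (- a - 1).
  rewrite w0/= ler_wpM2l ?(ltW a0)// -opprD !powRN lef_pV2 ?posrE ?powR_gt0//.
  by rewrite ge0_ler_powR ?nnegrE ?addr_ge0 ?(ltW a0) ?(ltW c0) ?(ltW (f0 x)).
have psiw x y : psi y - psi x <= w y * Num.max (f x - f y) 0.
  rewrite !psiE; apply: le_trans (powR_convex_tangent (ltW a0) (f0 y) (f0 x)) _.
  by apply: (ler_wpM2l (w0 y)); rewrite le_max lexx.
have psi_bnd x : `|psi x| <= c `^ (- a).
  rewrite psiE ger0_norm ?powR_ge0// !powRN lef_pV2 ?posrE ?powR_gt0//.
  by rewrite ge0_ler_powR ?nnegrE ?(ltW a0) ?(ltW c0) ?(ltW (f0 x)).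
have contw : continuous w by move=> x; apply: cvgMl_tmp; exact: cpow.
pose kappa := K / (6 * N).
have kappa0 : 0 < kappa by rewrite divr_gt0// mulr_gt0.
pose A := \int[nu]_x (f x `^ (q * p)).
have AE : \int[nu]_x (rho x `^ p) = A.
  by rewrite /A; apply: eq_Rintegral => x _; rewrite powRrM.
pose B := \int[Pi]_g (geodesic_length g ^+ 2).
have p0 : 0 < p by rewrite subr_gt0 invf_lt1// (lt_trans _ N2)// ltr1n.
(* n + 2, since the times must be less than 1 *)
have t_subproof n : 0 <= (n.+2%:R^-1 : R) <= 1.
  by rewrite invr_ge0 ler0n invf_le1// ler1n.
pose t n : {i01 R} :=
  Itv01 (proj1 (andP (t_subproof n))) (proj2 (andP (t_subproof n))).
have tE n : (t n)%:num = n.+2%:R^-1 :> R by [].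
have tn01 n : 0 < (t n)%:num < 1 by rewrite tE invr_gt0 ltr0n invf_lt1// ltr1n.
have tto0 : (t n)%:num @[n --> \oo] --> (0 : R).
  by have := @cvg_harmonic R; rewrite -cvg_shiftS.
pose J := \int[Pi]_g (w (geodesic_start g) *
                      fine (descending_slope f (geodesic_start g)) *
                      geodesic_length g).
have BJ : (1 + kappa * B - A) / p <= J.
  apply: (@first_variation R X cX Pi f psi w L (c `^ (- a))
    (a * c `^ (- a - 1)) _ t
    (fun n => (1 + kappa * (1 - (t n)%:num ^+ 2) * B - A) / p)) => //.
  - by rewrite (_ : psi = fun x => f x `^ (- a)); [exact: mf|exact/funext].
  - by move=> n; case/andP: (tn01 n).
  - move=> n; rewrite mulrA ler_pdivrMr// [leRHS]mulrC -AE.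
    exact: ineq.
  - rewrite [X in _ --> X](_ : _ = (1 + kappa * (1 - 0 ^+ 2) * B - A) / p);
        last first.
      by rewrite expr0n/= subr0 mulr1.
    apply: cvgM; last exact: cvg_cst.
    apply: cvgB; last exact: cvg_cst.
    apply: cvgD; first exact: cvg_cst.
    apply: cvgM; last exact: cvg_cst.
    apply: cvgM; first exact: cvg_cst.
    by apply: cvgB; [exact: cvg_cst|exact: (cvgM tto0 tto0)].
pose u x := w x * fine (descending_slope f x).
pose W := a * c `^ (- a - 1).
have u_bnd x : 0 <= u x <= W * L.
  by have /andP[_ wxW] := wW x; rewrite mulr_ge0//=; apply: ler_pM.
have mu : measurable_fun [set: borel X] (u : borel X -> R).
  by apply: measurable_funM => //; apply: measurable_funM => //; exact: mf.
(* As q = 2 (a + 1), w ^ 2 = a ^ 2 / rho. *)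
have rhou2 x : rho x * u x ^+ 2 = a ^+ 2 * fine (descending_slope f x) ^+ 2.
  have -> : u x ^+ 2 = a ^+ 2 * (f x `^ (- a - 1) * f x `^ (- a - 1)) *
      fine (descending_slope f x) ^+ 2 by rewrite /u /w; ring.
  have powD r s : f x `^ r * f x `^ s = f x `^ (r + s).
    by rewrite powRD//; apply/implyP => _; rewrite gt_eqF.
  rewrite powD mulrA [rho x * _]mulrCA powD.
  rewrite (_ : q + _ = 0) ?powRr0 ?mulr1//.
  by rewrite /a; field; rewrite gt_eqF.
have start_u2 : \int[Pi]_g (u (geodesic_start g) ^+ 2) =
    a ^+ 2 * \int[nu]_x (fine (descending_slope f x) ^+ 2).
  have mu2 : measurable_fun [set: borel X] (fun x : borel X => u x ^+ 2).
    exact: measurable_funX.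
  have ms2 : measurable_fun [set: borel X]
      (fun x : borel X => fine (descending_slope f x) ^+ 2).
    exact: measurable_funX.
  have u2_bnd x : `|u x ^+ 2| <= (W * L) ^+ 2 by exact: norm_sqr_le.
  have s2_bnd x : `|fine (descending_slope f x) ^+ 2| <= L ^+ 2.
    by apply: norm_sqr_le; rewrite s0 sL.
  apply: EFin_inj; rewrite -(EFin_bounded_Rintegral Pi (measurable_start mu2)
    (fun g => u2_bnd (geodesic_start g))).
  rewrite (start_law (fun x => u x ^+ 2))//; last by move=> x; exact: sqr_ge0.
  under eq_integral do rewrite rhou2.
  rewrite -RintegralZl//; last exact: bounded_integrable ms2 s2_bnd.
  apply: (@EFin_bounded_Rintegral _ _ _ nu _ (a ^+ 2 * L ^+ 2)).
    exact: measurable_funM.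
  move=> x; rewrite normrM [X in X * _]ger0_norm ?sqr_ge0//.
  by rewrite ler_wpM2l ?sqr_ge0.
have constE : p ^+ 2 / (4 * kappa) * a ^+ 2 =
    6 / (K * N) * ((N - 1) / (N - 2)) ^+ 2.
  by rewrite /kappa /a; field; rewrite !gt_eqF.
have := young_along_plan cX Pi p kappa0 mu u_bnd.
rewrite -/B -/J start_u2 mulrA constE => young.
have : 1 + kappa * B - A <= p * J by rewrite [leRHS]mulrC -ler_pdivrMr.
rewrite -/A; move: young.
move: (p * J) (kappa * B) (_ * _ * _) => x y z; lra.
Qed.

End sobolev.

Theorem theorem5p29 (R : realType) (X : pmetricType R)
  (nu : probability (borel X) R) (K N : R)
  (hN : 2 < N) (hK : 0 < K)
  (hcompact : compact [set: X]) (hlength : length_space X)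
  (hricci : ricci_bounded_below nu N K)
  (f : X -> R) (hf0 : forall x, 0 <= f x) (hflip : lipschitz_fun f)
  (hfnorm : (\int[nu]_x ((f x) `^ (2 * N / (N - 2)))%:E = 1)%E) :
  (1 - (\int[nu]_x (f x)%:E) `^ (2 / (N + 2)) <=
   (6 / (K * N) * (N / (N - 2)) ^+ 2)%:E *
     \int[nu]_x (descending_slope f x) ^+ 2)%E.
Proof.
set q := 2 * N / (N - 2) in hfnorm *; set th := 2 / (N + 2).
have [N0 N20 N10 N2p] : [/\ 0 < N, 0 < N - 2, 0 < N - 1 & 0 < N + 2].
  by split; lra.
have q0 : 0 < q by rewrite divr_gt0// mulr_gt0.
have th01 : 0 < th < 1 by rewrite divr_gt0//= ltr_pdivrMr//; lra.
have th0 : 0 < th by case/andP: th01.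
have thq : q * (1 - N^-1) = th + (1 - th) * q.
  by rewrite /q /th; field; rewrite !gt_eqF.
have [L L0 fL] := lipschitz_constant hflip.
have ms := measurable_fine_descending_slope (lipschitz_continuous hflip).
have s0 := fine_descending_slope_ge0 f.
have sL x := fine_descending_slope_le x L0 fL.
have [M fM] := lipschitz_bounded hcompact hflip.
have mf : measurable_fun [set: borel X] (f : borel X -> R).
  exact: continuous_borel (lipschitz_continuous hflip).
pose C := 6 / (K * N) * (N / (N - 2)) ^+ 2.
have C0 : 0 <= C.
  by apply: mulr_ge0; [rewrite divr_ge0// mulr_ge0 ?ltW|exact: sqr_ge0].
pose S2 := \int[nu]_x (fine (descending_slope f x) ^+ 2).
pose I := \int[nu]_x f x.
have I0 : 0 <= I by exact: Rintegral_ge0.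
have S2_ge0 : 0 <= S2 by apply: Rintegral_ge0 => x _; exact: sqr_ge0.
(* [sobolev_positive] for the normalization of f + e; the normalizing factor
is dropped because it is at least 1. *)
have main e : 0 < e -> 1 - C * S2 <= (I + e) `^ th.
  move=> e0; pose h x := f x + e; pose Z := \int[nu]_x (h x `^ q).
  have h0 x : 0 < h x by rewrite ltr_wpDl.
  have fM' x : f x <= M by exact: le_trans (ler_norm _) (fM x).
  have M0 : 0 <= M by exact: le_trans (hf0 point) (fM' point).
  have mh : measurable_fun [set: borel X] (h : borel X -> R).
    exact: measurable_funD.
  have mhq : measurable_fun [set: borel X] ((fun x => h x `^ q) : borel X -> R).
    exact: (measurableT_comp (measurable_powR q) mh).
  have hq_bnd x : `|h x `^ q| <= (M + e) `^ q.
    rewrite ger0_norm ?powR_ge0//.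
    rewrite ge0_ler_powR ?nnegrE ?(ltW q0) ?(ltW (h0 x))//.
      by rewrite addr_ge0// ltW.
    by rewrite lerD2r.
  have Z1 : 1 <= Z.
    rewrite -lee_fin -(EFin_bounded_Rintegral nu mhq hq_bnd) -hfnorm.
    apply: ge0_le_integral_any => x; first by rewrite lee_fin powR_ge0.
    rewrite lee_fin ge0_ler_powR ?nnegrE ?(ltW q0) ?(ltW (h0 x))//.
    by rewrite lerDl ltW.
  have Z0 : 0 < Z by exact: lt_le_trans Z1.
  pose z := Z `^ q^-1.
  have z1 : 1 <= z.
    have <- : 1 `^ q^-1 = 1 :> R by rewrite powR1.
    by rewrite ge0_ler_powR ?nnegrE ?invr_ge0 ?(ltW q0) ?(ltW Z0).
  have z0 : 0 < z by exact: lt_le_trans z1.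
  have zq : z `^ q = Z by rewrite -powRrM mulVf ?gt_eqF// powRr1// ltW.
  pose g x := h x / z.
  have ge x : e / z <= g x by rewrite ler_wpM2r ?invr_ge0 ?(ltW z0)// lerDr.
  have g0 x : 0 <= g x by rewrite divr_ge0 ?ltW.
  have mg : measurable_fun [set: borel X] (g : borel X -> R).
    exact: measurable_funM.
  have gM x : 0 <= g x <= (M + e) / z.
    by rewrite g0/= ler_wpM2r ?invr_ge0 ?(ltW z0)// lerD2r.
  have gB x y : g x - g y = (f x - f y) / z by rewrite /g /h; ring.
  have zV1 : z^-1 <= 1 by rewrite invf_le1.
  have lg : lipschitz_fun g.
    exists L => x y; rewrite gB normrM normfV [X in _ / X]gtr0_norm//.
    by apply: le_trans (fL x y); rewrite ler_piMr.
  have gq1 : \int[nu]_x (g x `^ q) = 1.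
    have -> : \int[nu]_x (g x `^ q) = \int[nu]_x (h x `^ q / Z).
      apply: eq_Rintegral => x _.
      rewrite powRM ?invr_ge0 ?(ltW z0) ?(ltW (h0 x))//.
      by rewrite -powR_inv1 ?(ltW z0)// -powRrM mulN1r powRN zq.
    rewrite RintegralZr//; last exact: bounded_integrable mhq hq_bnd.
    by rewrite -/Z divff// gt_eqF.
  have ih : nu.-integrable setT (EFin \o h).
    apply: (@bounded_integrable _ _ _ nu _ (M + e)) => // x.
    by rewrite ger0_norm ?(ltW (h0 x))// lerD2r.
  have intg : \int[nu]_x g x = (I + e) / z.
    rewrite RintegralZr// RintegralD//; last 2 first.
    - exact: bounded_integrable mf fM.
    - exact: finite_measure_integrable_cst.
    by rewrite Rintegral_cst// [X in fine X]probability_setT mulr1.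
  have Ie : 0 < I + e by rewrite ltr_wpDl.
  have [Lg Lg0 gL] := lipschitz_constant lg.
  have msg := measurable_fine_descending_slope (lipschitz_continuous lg).
  have sg0 := fine_descending_slope_ge0 g.
  have sgL x := fine_descending_slope_le x Lg0 gL.
  have slope_le x : fine (descending_slope g x) <= fine (descending_slope f x).
    rewrite fine_le ?fin_num_descending_slope//.
    apply: descending_slope_le => y.
    rewrite ler_wpM2r ?invr_ge0 ?mdist_ge0// gB ge_max !le_max lexx orbT andbT.
    have [fxy|fxy] := leP 0 (f x - f y).
      by rewrite ler_piMr.
    by rewrite mulr_le0_ge0 ?orbT ?invr_ge0 ?ltW.
  have is2 (u : X -> R) (l : R) :
      measurable_fun [set: borel X] (u : borel X -> R) ->
      (forall x, 0 <= u x) -> (forall x, u x <= l) ->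
      nu.-integrable setT (EFin \o (fun x : borel X => u x ^+ 2)).
    move=> mu u0 ul; apply: (@bounded_integrable _ _ _ nu _ (l ^+ 2)).
      exact: measurable_funX.
    by move=> x; apply: norm_sqr_le; rewrite u0 ul.
  have := sobolev_positive hN hK hcompact hricci lg (divr_gt0 e0 z0) ge gq1.
  rewrite thq => sob.
  have interp : \int[nu]_x (g x `^ (th + (1 - th) * q)) <= (I + e) `^ th.
    apply: le_trans (Rintegral_interpolation mg gM th01 q0 gq1 _) _.
      by rewrite intg divr_gt0.
    rewrite intg.
    rewrite ge0_ler_powR ?nnegrE ?(ltW th0) ?divr_ge0 ?(ltW Ie) ?(ltW z0)//.
    by rewrite ler_piMr// ltW.
  have energy : 6 / (K * N) * ((N - 1) / (N - 2)) ^+ 2 *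
      \int[nu]_x (fine (descending_slope g x) ^+ 2) <= C * S2.
    apply: ler_pM.
    - by apply: mulr_ge0; [rewrite divr_ge0// mulr_ge0 ?ltW|exact: sqr_ge0].
    - by apply: Rintegral_ge0 => x _; exact: sqr_ge0.
    - apply: ler_wpM2l; first by rewrite divr_ge0// mulr_ge0 ?ltW.
      rewrite ler_sqr ?nnegrE ?divr_ge0 ?(ltW N10) ?(ltW N20) ?(ltW N0)//.
      by rewrite ler_wpM2r ?invr_ge0 ?(ltW N20)// gerBl.
    - apply: le_Rintegral => //; [exact: is2 msg sg0 sgL|exact: is2 ms s0 sL|].
      by move=> x _; rewrite ler_sqr ?nnegrE.
  move: sob interp energy; clear; lra.
have S2E : (\int[nu]_x (descending_slope f x) ^+ 2 = S2%:E)%E.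
  rewrite -(@EFin_bounded_Rintegral _ _ _ nu _ (L ^+ 2)).
  - apply: eq_integral => x _.
    by rewrite EFin_expe fineK// fin_num_descending_slope.
  - exact: measurable_funX.
  - by move=> x; apply: norm_sqr_le; rewrite s0 sL.
rewrite S2E (EFin_bounded_Rintegral nu mf fM) poweR_EFin -EFinB -EFinM lee_fin.
rewrite -/I -/C lerBlDr addrC -lerBlDr.
have [neg|pos] := leP (1 - C * S2) 0; first exact: le_trans neg (powR_ge0 _ _).
have root y : 0 <= y -> (y `^ th^-1) `^ th = y.
  by move=> y0; rewrite -powRrM mulVf ?gt_eqF// powRr1.
rewrite -[leLHS](root _ (ltW pos)) ge0_ler_powR ?nnegrE ?powR_ge0 ?(ltW th0)//.
apply/ler_addgt0Pr => e e0.
have Ie : 0 <= I + e by rewrite addr_ge0// ltW.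
have -> : I + e = ((I + e) `^ th) `^ th^-1.
  by rewrite -powRrM divff ?gt_eqF// powRr1.
by apply: ge0_ler_powR (main e e0); rewrite ?nnegrE ?powR_ge0 ?invr_ge0 ?ltW.
Qed.
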